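(* Consider a single dipole at $\vec y_*=(y_*,L+\eta_* )$ with polarization vector $\vec p_*\in\mathbb C^3$, $\|\vec p_*\|=\mathcal O(1)$. In the Fraunhofer regime, the Kirchhoff imaging function satisfies, for imaging points $\vec y=(y,L+\eta_* )$ with $y\ne y_*$, $$\|\vec{\mathcal I}_{\mathrm{KM}}(\vec y;k)\|=\frac{a^2}{L^2}\left(\mathcal O\Big(\frac{L}{a\,k\,\|y-y_*\|}\Big)+o(1)\right),$$ where the $o(1)$ is explicitly given by $\mathcal O(a^2\Theta_a/L^2)+\mathcal O(\Theta_b)$. When the array $\mathcal A$ is a disk of radius $a$, one has $$\vec{\mathcal I}_{\mathrm{KM}}(\vec y_*;k)=\frac{a^2}{16\pi L^2}\begin{pmatrix}1&0&0\\0&1&0\\0&0&0\end{pmatrix}\vec p_*+o\!\left(\frac{a^2}{L^2}\right).$$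
   Context: Notation. Points of $\mathbb R^3$ are written $\vec x=(x,z)$ with $x\in\mathbb R^2$ the cross-range part and $z$ the range part. $c>0$ is the wave speed, $\mu>0$ the magnetic permeability, $\omega>0$ the angular frequency, $k=\omega/c$. With $\vec r=\vec x-\vec y$, $r=\|\vec r\|$, $m(kr)=(\mathrm i kr-1)/(kr)^2$, and $G(\vec x,\vec y;k)=\frac{e^{\mathrm i k\|\vec x-\vec y\|}}{4\pi\|\vec x-\vec y\|}$, the dyadic Green function is the $3\times3$ matrix $$\mathbb G(\vec x,\vec y;k)=G(\vec x,\vec y;k)\Big[(1+m(kr))\mathbb I-(1+3m(kr))\frac{\vec r\,\vec r^{\top}}{r^2}\Big].$$ Array, data, image. The array is $\mathcal A\subset\mathbb R^2$ of characteristic size $a$, i.e. $\mathcal A=a\widetilde{\mathcal A}$ with $\widetilde{\mathcal A}\subset\mathbb R^2$ a fixed bounded domain with piecewise smooth boundary (a disk array of radius $a$ is $\{x_r\in\mathbb R^2:\|x_r\|\le a\}$); receivers are $\vec x_r=(x_r,0)$, $x_r\in\mathcal A$. The data are $\vec\Pi(x_r;k)=\mu\omega^2\,\mathbb G(\vec x_r,\vec y_*;k)\vec p_*$, and $$\vec{\mathcal I}_{\mathrm{KM}}(\vec y;k)=(\mu\omega^2)^{-1}\int_{\mathcal A}\overline{\mathbb G(\vec x_r,\vec y;k)}\,\vec\Pi(x_r;k)\,\mathrm dx_r .$$ Fraunhofer regime. Imaging points and the dipole position lie in the imaging window: they are of the form $(y,L+\eta)$ with $\|y\|=\mathcal O(b)$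 and $|\eta|=\mathcal O(h)$. Put $\Theta_a=ka^2/L$, $\Theta_b=kb^2/L$, $\Theta_h=kh^2/L$. The parameters $(k,L,a,b,h)$ vary so that $kL\gg1$, $a\ll L$, $b\ll L$, $h\ll L$, $\Theta_b\ll1$, $1\ll\Theta_a\ll L^2/a^2$ and $kh=\mathcal O(1)$, where $X\ll Y$ means $X/Y\to0$. The symbols $\mathcal O$, $o$ refer to this limit, uniformly over points of the imaging window. *)

(* Defs.v *)
From HB Require Import structures.
From mathcomp Require Import all_boot all_order all_algebra.
From mathcomp Require Import complex.
From mathcomp Require Import all_classical all_reals all_analysis.

Set Implicit Arguments.
Unset Strict Implicit.
Unset Printing Implicit Defensive.

Import Order.TTheory GRing.Theory Num.Theory.
Import numFieldNormedType.Exports.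

Local Open Scope classical_set_scope.
Local Open Scope ring_scope.
Local Open Scope complex_scope.

Section Geometry.
Context {R : realType}.

(* The library norms on R * R and on matrices are max norms, hence the
   Euclidean norms below. *)
Definition norm2 (x : R * R) : R := Num.sqrt (x.1 ^+ 2 + x.2 ^+ 2).

Definition enorm n (v : 'cV[R]_n) : R := Num.sqrt (\sum_i v i 0 ^+ 2).

Definition cnorm n (v : 'cV[R[i]]_n) : R :=
  Num.sqrt (\sum_i (complex.Re (v i 0) ^+ 2 + complex.Im (v i 0) ^+ 2)).

Definition point (x : R * R) (z : R) : 'cV[R]_3 :=
  \col_(i < 3) nth 0 [:: x.1; x.2; z] i.

Definition disk (a : R) : set (R * R) := [set x | norm2 x <= a].

Definition scale_set (a : R) (A : set (R * R)) : set (R * R) :=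
  [set (a * x.1, a * x.2) | x in A].

Definition boundary (A : set (R * R)) : set (R * R) := closure A `\` A°.

Definition C1 (f : R -> R) : Prop :=
  (forall s, derivable f s 1) /\ continuous (derive1 f).

(* A regular C^1 parametrization of an arc over [0, 1] extends to a C^1 map on
   the whole line, so f and g may be taken C^1 on R. *)
Definition smooth_arc (S : set (R * R)) : Prop :=
  exists f g : R -> R,
    [/\ C1 f, C1 g,
        forall s, 0 <= s <= 1 -> (derive1 f s, derive1 g s) <> (0, 0)
      & S = [set (f s, g s) | s in `[0, 1]]].

Definition piecewise_smooth (S : set (R * R)) : Prop :=
  exists (n : nat) (arc : 'I_n -> set (R * R)),
    (forall i, smooth_arc (arc i)) /\ S = \bigcup_(i in [set: 'I_n]) arc i.

(* A bounded domain taken with any part of its boundary: both the open and the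
   closed disk qualify. *)
Definition array_shape (A : set (R * R)) : Prop :=
  measurable (A : set (measurableTypeR R * measurableTypeR R)) /\
  exists D : set (R * R),
    [/\ [/\ open D, connected D & D !=set0],
        bounded_set D,
        piecewise_smooth (boundary D)
      & D `<=` A /\ A `<=` closure D].

End Geometry.

Section Imaging.
Context {R : realType}.

Definition expi (t : R) : R[i] := cos t +i* sin t.

Definition greenm (s : R) : R[i] := ('i * s%:C - 1) / (s ^+ 2)%:C.

Definition green (x y : 'cV[R]_3) (k : R) : R[i] :=
  expi (k * enorm (x - y)) / (4 * pi * enorm (x - y))%:C.

Definition dyadic_green (x y : 'cV[R]_3) (k : R) : 'M[R[i]]_3 :=
  let v := x - y in
  let r := enorm v in
  let m := greenm (k * r) in
  green x y k *:
    ((1 + m) *: 1%:M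
     - (1 + 3 * m) *: map_mx (real_complex R) (r ^- 2 *: (v *m v^T))).

Definition conj_mx m n (A : 'M[R[i]]_(m, n)) : 'M[R[i]]_(m, n) :=
  map_mx (@conjc R) A.

Definition area :=
  (@lebesgue_measure R \x @lebesgue_measure R)%E.

Definition integral_vec n (A : set (R * R)) (f : R * R -> 'cV[R[i]]_n) :
    'cV[R[i]]_n :=
  \col_i ((\int[area]_(x in A) complex.Re (f x i 0))%R
          +i* (\int[area]_(x in A) complex.Im (f x i 0))%R).

Definition dipole_data (mu omega k : R) (ystar : 'cV[R]_3) (p : 'cV[R[i]]_3)
    (xr : R * R) : 'cV[R[i]]_3 :=
  (mu * omega ^+ 2)%:C *: (dyadic_green (point xr 0) ystar k *m p).

Definition kirchhoff (mu omega k : R) (A : set (R * R))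
    (data : R * R -> 'cV[R[i]]_3) (y : 'cV[R]_3) : 'cV[R[i]]_3 :=
  ((mu * omega ^+ 2)^-1)%:C *:
    integral_vec A (fun xr => conj_mx (dyadic_green (point xr 0) y k) *m data xr).

Definition cross_range_proj : 'M[R[i]]_3 :=
  diag_mx (\row_(j < 3) nth 0 [:: 1; 1; 0] j).

End Imaging.

Section Asymptotics.
Context {R : realType} {T : Type}.
Variable F : set_system T.

Definition much_less (X Y : T -> R) : Prop :=
  (fun t => X t / Y t) @ F --> (0 : R).

(* f = O(g) and f = o(g) along F, uniformly over the q in W t. *)
Definition unif_bigO (P : Type) (W : T -> set P) (f g : T -> P -> R) : Prop :=
  exists C : R, \forall t \near F, forall q, W t q -> `|f t q| <= C * `|g t q|.

Definition unif_littleo (P : Type) (W : T -> set P) (f g : T -> P -> R) : Prop :=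
  forall e : R, 0 < e ->
    \forall t \near F, forall q, W t q -> `|f t q| <= e * `|g t q|.

Definition Theta (k L s : T -> R) : T -> R := fun t => k t * s t ^+ 2 / L t.

Record fraunhofer (k L a b h : T -> R) : Prop := Fraunhofer {
  fraunhofer_pos : forall t, [/\ 0 < k t, 0 < L t, 0 < a t, 0 < b t & 0 < h t];
  fraunhofer_kL : much_less (fun=> 1) (fun t => k t * L t);
  fraunhofer_aL : much_less a L;
  fraunhofer_bL : much_less b L;
  fraunhofer_hL : much_less h L;
  fraunhofer_Thetab : much_less (Theta k L b) (fun=> 1);
  fraunhofer_Thetaa : much_less (fun=> 1) (Theta k L a);
  fraunhofer_Thetaa_le : much_less (Theta k L a) (fun t => L t ^+ 2 / a t ^+ 2);
  fraunhofer_kh : exists C : R, \forall t \near F, k t * h t <= C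
}.

End Asymptotics.

(* A dipole at (crange, L + offset) with polarization vector polar. *)
Record dipole (R : realType) := Dipole {
  crange : R * R;
  offset : R;
  polar : 'cV[R[i]]_3
}.

(* The constant M is the one implicit in |y| = O(b), |eta| = O(h) and
   |p| = O(1). *)
Definition window (R : realType) (T : Type) (M : R) (b h : T -> R) (t : T) :
    set ((R * R) * R) :=
  [set q | norm2 q.1 <= M * b t /\ `|q.2| <= M * h t].

Definition admissible (R : realType) (T : Type) (M : R) (b h : T -> R) (t : T) :
    set (dipole R) :=
  [set d | window M b h t (crange d, offset d) /\ cnorm (polar d) <= M].

(* The dipole together with the cross-range y of an imaging point at the same
   range; y differs from the cross-range of the dipole. *)
Definition admissible_off (R : realType) (T : Type) (M : R) (b h : T -> R)
    (t : T) : set (dipole R * (R * R)) :=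
  [set q | [/\ admissible M b h t q.1, window M b h t (q.2, offset q.1)
             & q.2 <> crange q.1]].

Definition image_dipole (R : realType) (mu omega k L : R) (A : set (R * R))
    (d : dipole R) (y : R * R) : 'cV[R[i]]_3 :=
  kirchhoff mu omega k A
    (dipole_data mu omega k (point (crange d) (L + offset d)) (polar d))
    (point y (L + offset d)).

(* Main.v *)
Require Import Defs.
From HB Require Import structures.
From mathcomp Require Import all_boot all_order all_algebra.
From mathcomp Require Import complex.
From mathcomp Require Import all_classical all_reals all_analysis.
From mathcomp Require Import measurable_realfun ring lra.


Set Implicit Arguments.
Unset Strict Implicit.
Unset Printing Implicit Defensive.

Import Order.TTheory GRing.Theory Num.Theory.
Import numFieldNormedType.Exports.

Local Open Scope classical_set_scope.
Local Open Scope ring_scope.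
Local Open Scope complex_scope.

(* Write Z = L + eta and r, r' for the distances from a receiver to y and y'.
   Scaled by Z / r, the bracket of the dyadic Green function differs from
   diag(1, 1, 0) by O((a + b) / L + 1 / (k L)), and the phase k (r' - r) differs
   from the linear phase xi . x, xi = k (y - y') / Z, by
   O(k a^4 / L^3 + k b^2 / L).  The first order amplitude errors are dominated by
   the three error terms of the theorem, so only the integral of e^{i xi . x} over
   the array is left.

   That integral is O(a / |xi|): translating by tau = pi xi / |xi|^2 changes the
   sign of the integrand, so twice the integral lives on the symmetric difference
   of the array and its translate.  A segment of direction tau starting there
   crosses the boundary of the array, so the symmetric difference is covered by
   O(a / |tau|) squares of side O(|tau|) centred on the boundary arcs.

   At y = y' on a disk the phase is 0 and the integral is the area pi a^2. *)

(** * Translations and squares in the plane *)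

Section Plane.
Context {R : realType}.
Notation plane := (measurableTypeR R * measurableTypeR R)%type.
Notation mu := (@lebesgue_measure R).
Notation area := (@area R).

(** The stated remainder contains only [a^2 Theta_a / L^2] and [Theta_b], whereas the amplitude
    errors [a / L], [b / L], [1 / (k L)] are of neither form. They can be absorbed because both
    points lie in the window: [|y - y_*| <= 4 M b], so the term [L / (a k |y - y_*|)] is never
    smaller than a multiple of [L / (a k b)]. On the dipole that term is absent; the same errors are
    kept there and merely tend to 0.

    The boundary of the array is only a finite union of C^1 arcs. Integration by parts would call
    for a divergence theorem on such a domain; the translation argument needs just a covering of the
    boundary, and it is indifferent to which boundary points belong to the array.

    Every estimate is a plain inequality with constants depending on the shape and on [M] alone,
    valid once a few ratios are below a fixed threshold. Uniformity over the window is then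
    automatic, and limits occur only in the last step. *)

Definition shift2 (u x : plane) : plane := (x.1 + u.1, x.2 + u.2).

Lemma measurable_shift1 (t : R) :
  measurable_fun setT (fun x : measurableTypeR R => x + t : measurableTypeR R).
Proof. exact: measurable_funD. Qed.

(** The pushforward of Lebesgue measure by a translation has the right value on half-open intervals,
    and these values determine the measure. *)
Lemma lebesgue_measure_shift (t : R) (A : set (measurableTypeR R)) :
  measurable A -> mu ((fun x => x + t) @^-1` A) = mu A.
Proof.
move=> mA; have mt := measurable_shift1 t.
pose m' : {measure set (measurableTypeR R) -> \bar R} :=
  pushforward mu (fun x : measurableTypeR R => x + t : measurableTypeR R).
rewrite -[LHS]/(m' mt A); apply/esym/lebesgue_measure_unique => // X [[u v] /= uv <-].
rewrite /m' /= /pushforward.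
rewrite (_ : (fun x => x + t) @^-1` `]u, v] = `]u - t, v - t]%classic); last first.
  apply/seteqP; split => x /=; rewrite !in_itv /= => /andP[? ?]; apply/andP; split; lra.
rewrite !lebesgue_measure_itv /= !lte_fin.
have -> : (u - t < v - t) = (u < v) by rewrite ltrD2r.
by case: ifP => // _; rewrite -!EFinD; congr (_%:E); lra.
Qed.

Lemma measurable_shift2 (u : plane) : measurable_fun setT (shift2 u).
Proof.
by apply: measurable_fun_pair; apply: measurable_funD.
Qed.

(** Uniqueness of the product measure: on rectangles the claim splits into two one-dimensional
    translations. *)
Lemma area_shift (u : plane) (A : set plane) :
  measurable A -> area (shift2 u @^-1` A) = area A.
Proof.
move=> mA; have ms := measurable_shift2 u.
pose m' : {measure set plane -> \bar R} := pushforward area (shift2 u).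
rewrite -[LHS]/(m' ms A); apply/esym/product_measure_unique => // X Y mX mY.
rewrite /m' /= /pushforward.
rewrite (_ : shift2 u @^-1` (X `*` Y) =
   ((fun x => x + u.1) @^-1` X) `*` ((fun x => x + u.2) @^-1` Y)) //.
have pre t Z : measurable Z ->
    measurable ((fun x : measurableTypeR R => x + t : measurableTypeR R) @^-1` Z).
  by move=> mZ; rewrite -[X in measurable X]setTI; apply: measurable_shift1.
rewrite /area product_measure1E; [|exact: pre|exact: pre].
by congr (_ * _)%E; exact: lebesgue_measure_shift.
Qed.

Lemma integral_area_shift (u : plane) (S : set plane) (f : plane -> R) :
  measurable S -> measurable_fun setT f ->
  area.-integrable (shift2 u @^-1` S) ((EFin \o f) \o shift2 u) ->
  \int[area]_(x in S) f x = \int[area]_(x in shift2 u @^-1` S) f (shift2 u x).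
Proof.
move=> mS mf fi; have ms := measurable_shift2 u.
have me : measurable_fun setT (EFin \o f) by exact/measurable_EFinP.
have H := integral_pushforward ms me fi mS.
rewrite /Rintegral; congr (fine _); rewrite -[RHS]H.
apply: eq_measure_integral => X mX _.
exact/esym/area_shift.
Qed.

Definition box (c : R * R) (r : R) : set plane :=
  `[c.1 - r, c.1 + r] `*` `[c.2 - r, c.2 + r].

Lemma measurable_box c r : measurable (box c r).
Proof. exact: measurableX. Qed.

Lemma area_box c r : 0 <= r -> area (box c r) = ((2 * r) ^+ 2)%:E.
Proof.
move=> r0.
have H z : mu `[z - r, z + r] = (2 * r)%:E.
  rewrite lebesgue_measure_itv /= lte_fin.
  by case: ifPn => h; rewrite -?EFinB; congr (_%:E); lra.
rewrite expr2 EFinM -{1}(H c.1) -(H c.2).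
exact: product_measure1E.
Qed.

(** One measurable set stands for the union of the squares, so that later only its area matters;
    overlaps are paid for by subadditivity. *)
Lemma boxes_hull (s : seq (R * R)) (r : R) : 0 <= r ->
  exists E : set plane, [/\ measurable E, forall c, c \in s -> box c r `<=` E
    & (area E <= ((size s)%:R * (2 * r) ^+ 2)%:E)%E].
Proof.
move=> r0; elim: s => [|c s [E [mE sE aE]]].
  by exists set0; split => //; rewrite mul0r [area _]measure0.
exists (box c r `|` E); split.
- by apply: measurableU => //; exact: measurable_box.
- move=> x; rewrite in_cons => /predU1P[->|/sE xE]; first exact: subsetUl.
  exact/(subset_trans xE)/subsetUr.
- have aU : (area (box c r `|` E) <= area (box c r) + area E)%E.
    exact: (measureU2 area (measurable_box c r) mE).
  apply: (le_trans aU).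
  have -> : (size (c :: s))%:R * (2 * r) ^+ 2 =
      (2 * r) ^+ 2 + (size s)%:R * (2 * r) ^+ 2 :> R.
    by rewrite /= -[(size s).+1%:R]natr1 mulrDl mul1r addrC.
  by rewrite area_box // EFinD leeD.
Qed.
End Plane.

(** * Boundary arcs *)

Section Cover.
Context {R : realType}.
Implicit Types G D A : set (R * R).

(** Mean value theorem, with the derivative bounded on the compact [[0, 1]]. *)
Lemma C1_lipschitz (f : R -> R) : C1 f ->
  exists2 K : R, 0 <= K & forall u v, 0 <= u <= 1 -> 0 <= v <= 1 ->
    `|f u - f v| <= K * `|u - v|.
Proof.
move=> [df cdf].
have : bounded_set (derive1 f @` `[0, 1]).
  apply/compact_bounded/continuous_compact; last exact: segment_compact.
  exact: continuous_subspaceT.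
case=> M [_ /(_ (`|M| + 1))] HM.
have {}HM s : 0 <= s <= 1 -> `|derive1 f s| <= `|M| + 1.
  move=> s01; apply: HM; first by rewrite ltr_pwDr // ler_norm.
  by exists s => //=; rewrite in_itv.
exists (`|M| + 1) => // u v.
wlog vu : u v / v <= u.
  move=> H u01 v01; case: (leP v u) => [|/ltW] h; first exact: H.
  by rewrite distrC [in leRHS]distrC; exact: H.
move=> /andP[u0 u1] /andP[v0 v1].
have [||c] := @MVT_segment R f (derive1 f) v u vu.
- by move=> x _; split => //; rewrite derive1E.
- apply: continuous_subspaceT => x; apply/differentiable_continuous/derivable1_diffP; exact: df.
rewrite in_itv /= => /andP[vc cu] ->; rewrite normrM ler_wpM2r //; apply: HM.
by rewrite (le_trans v0 vc) (le_trans cu u1).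
Qed.

(* Finite one-dimensional upper Minkowski content. *)
Definition linearly_coverable G := exists C : nat, forall N : nat, (0 < N)%N ->
  exists s : seq (R * R), (size s <= C * N)%N /\
    forall z, G z -> exists2 c : R * R, c \in s & box c (C%:R / N%:R) z.

Lemma box_le (c : R * R) (r r' : R) : r <= r' -> box c r `<=` box c r'.
Proof.
move=> rr' z [] /=; rewrite !in_itv /= => /andP[? ?] /andP[? ?].
by split => /=; rewrite in_itv /=; apply/andP; split; lra.
Qed.

Lemma linearly_coverable0 : linearly_coverable set0.
Proof. by exists 0%N => N _; exists [::]; split. Qed.

Lemma linearly_coverableU G1 G2 : linearly_coverable G1 ->
  linearly_coverable G2 -> linearly_coverable (G1 `|` G2).
Proof.
move=> [C1 H1] [C2 H2]; exists (C1 + C2)%N => N N0.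
have [s1 [ss1 Hs1]] := H1 _ N0; have [s2 [ss2 Hs2]] := H2 _ N0.
exists (s1 ++ s2); split; first by rewrite size_cat mulnDl leq_add.
have N0' : (0 : R) <= N%:R^-1 by rewrite invr_ge0.
move=> z [/Hs1|/Hs2] [c cs bz]; exists c; rewrite ?mem_cat ?cs ?orbT //;
  by apply: box_le bz; rewrite ler_wpM2r // ler_nat ?leq_addl ?leq_addr.
Qed.

(** The parameter is sampled at the N + 1 points j / N; Lipschitz continuity keeps the arc within
    O(1 / N) of the samples. *)
Lemma smooth_arc_coverable G : smooth_arc G -> linearly_coverable G.
Proof.
move=> [f [g [/C1_lipschitz[K K0 Kf] /C1_lipschitz[K' K'0 Kg] _ ->]]].
(* One constant plays two parts: it bounds both Lipschitz constants, and being at least 2 it gives N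
   + 1 <= C N for N >= 1. *)
pose C := (Num.trunc (K + K')).+2.
have KC : K + K' <= C%:R.
  rewrite ltW // (lt_le_trans (truncnS_gt _)) // ler_nat /C //.
exists C => N N0.
pose s := [seq (f (j%:R / N%:R), g (j%:R / N%:R)) | j <- iota 0 N.+1].
exists s; split.
  by rewrite /s size_map size_iota /C !mulSn addnA (leq_trans _ (leq_addr _ _)) // -addn1 leq_add2l.
have N0' : (0 : R) < N%:R by rewrite ltr0n.
move=> z [u]; rewrite /= in_itv /= => /andP[u0 u1] <-.
have uN0 : 0 <= u * N%:R by rewrite mulr_ge0 // ltW.
pose j := Num.trunc (u * N%:R).
have /andP[j1 j2] : j%:R <= u * N%:R < j.+1%:R by rewrite /j truncn_itv.
have jN : (j <= N)%N by rewrite -(ler_nat R) (le_trans j1) // -[leRHS]mul1r ler_wpM2r // ltW.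
exists (f (j%:R / N%:R), g (j%:R / N%:R)).
  by apply: (map_f (fun j : nat => (f (j%:R / N%:R), g (j%:R / N%:R)))); rewrite mem_iota.
have ju : `|u - j%:R / N%:R| <= N%:R^-1.
  rewrite ger0_norm ?subr_ge0 ?ler_pdivrMr // lerBlDr.
  rewrite -[X in X + _]mul1r -mulrDl ler_pdivlMr // addrC natr1 ltW //.
have j01 : 0 <= (j%:R / N%:R : R) <= 1.
  by rewrite divr_ge0 //= ler_pdivrMr // mul1r ler_nat.
have u01 : 0 <= u <= 1 by rewrite u0.
have Kju K0' : 0 <= K0' -> K0' <= K + K' -> K0' * `|u - j%:R / N%:R| <= C%:R / N%:R.
  by move=> ? ?; apply: ler_pM => //; apply: le_trans KC.
have Hf := le_trans (Kf _ _ u01 j01) (Kju _ K0 ltac:(lra)).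
have Hg := le_trans (Kg _ _ u01 j01) (Kju _ K'0 ltac:(lra)).
move: Hf Hg; rewrite !ler_distl => /andP[? ?] /andP[? ?].
by split => /=; rewrite in_itv /=; apply/andP; split.
Qed.

Lemma piecewise_smooth_coverable G : piecewise_smooth G -> linearly_coverable G.
Proof.
move=> [n [arc [sarc ->]]].
suff H : forall s : seq 'I_n, linearly_coverable (\big[setU/set0]_(i <- s) arc i).
  have := H (index_enum 'I_n); rewrite -bigcup_seq.
  rewrite (_ : [set` _] = setT) //.
  by apply/seteqP; split => i //= _; rewrite mem_index_enum.
elim=> [|i s IH]; first by rewrite big_nil; exact: linearly_coverable0.
rewrite big_cons; apply: linearly_coverableU => //; exact: smooth_arc_coverable.
Qed.

(** Along a segment that misses the boundary, [D] and its closure have the same trace, which is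
    therefore open and closed in the connected [[0, 1]]: it is empty or everything. Since [A] lies
    between the two, both ends belong to [A] as soon as one does. *)
Lemma boundary_crossing D A (x u : R * R) : open D -> D `<=` A -> A `<=` closure D ->
  A x <> A (x.1 + u.1, x.2 + u.2) ->
  exists2 s, 0 <= s <= 1 & boundary D (x.1 + s * u.1, x.2 + s * u.2).
Proof.
move=> oD DA AD xu; apply: contrapT => nb; apply: xu.
pose c s : R * R := (x.1 + s * u.1, x.2 + s * u.2).
have cc : continuous c.
  have lc (p q : R) : continuous (fun s : R => p + s * q).
    by move=> s; apply: cvgD; [exact: cvg_cst|apply: cvgM; [exact: cvg_id|exact: cvg_cst]].
  by move=> s; apply: (cvg_pair (lc x.1 u.1 s) (lc x.2 u.2 s)).
have cD s : 0 <= s <= 1 -> closure D (c s) -> D (c s).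
  move=> s01 Hs; apply: contrapT => nD; apply: nb; exists s => //; split => //.
  by move=> /interior_subset.
have c0 : c 0 = x by rewrite /c !mul0r !addr0; case: (x).
have c1 : c 1 = (x.1 + u.1, x.2 + u.2) by rewrite /c !mul1r.
have main : (A x \/ A (c 1)) -> (A x /\ A (c 1)).
  move=> h.
  have E : `[0, 1]%classic `&` c @^-1` D = `[0, 1]%classic.
    apply: (@segment_connected R 0 1).
    - have [s s01 As] : exists2 s, 0 <= s <= 1 & A (c s).
        by case: h => h; [exists 0|exists 1]; rewrite ?c0 ?lexx ?ler01.
      exists s; split => /=; first by rewrite in_itv.
      exact/cD/AD.
    - by exists (c @^-1` D) => //; move/continuousP: cc; exact.
    - exists (c @^-1` closure D).
        by move/continuous_closedP: cc; apply; exact: closed_closure.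
      apply/seteqP; split => s [s01 Hs]; split => //=.
        exact: subset_closure.
      by apply: cD => //; move: s01; rewrite /= in_itv.
  have D01 s : 0 <= s <= 1 -> D (c s).
    move=> s01; have : (`[0, 1]%classic `&` c @^-1` D) s by rewrite E /= in_itv.
    by case.
  by split; [rewrite -c0|]; apply/DA/D01; rewrite ?lexx ?ler01.
apply/propext; rewrite -c1; split => h.
  by have [] := main (or_introl h).
by have [] := main (or_intror h).
Qed.
End Cover.

(** * Oscillatory integrals over the array *)

Section BoundedIntegrals.
Context d (X : measurableType d) {R : realType}.
Variable m : {measure set X -> \bar R}.

Lemma integrable_bounded (S : set X) (f : X -> R) (M : R) :
  measurable S -> (m S < +oo)%E -> measurable_fun setT f ->
  (forall x, S x -> `|f x| <= M) -> m.-integrable S (EFin \o f).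
Proof.
move=> mS Soo mf fM; apply: measurable_bounded_integrable => //.
  exact: measurable_funTS.
exists M; split; first exact: num_real.
by move=> y My x Sx; apply: le_trans (ltW My); exact: fM.
Qed.

Lemma norm_Rintegral_le (S : set X) (f : X -> R) (M : R) :
  measurable S -> (m S < +oo)%E -> measurable_fun setT f ->
  (forall x, S x -> `|f x| <= M) ->
  `|\int[m]_(x in S) f x| <= M * fine (m S).
Proof.
move=> mS Soo mf fM.
have fi := integrable_bounded mS Soo mf fM.
apply: (le_trans (le_normr_Rintegral mS fi)).
rewrite -Rintegral_cst //; apply: le_Rintegral => //.
- exact: (integrable_norm fi).
- apply: (@integrable_bounded _ _ `|M|) => //.
Qed.
End BoundedIntegrals.

Section Decay.
Context {R : realType}.
Notation plane := (measurableTypeR R * measurableTypeR R)%type.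
Notation area := (@area R).
Implicit Types S D A : set (R * R).

(** [J] cancels in 2 I = I - I' = K - L. *)
Lemma antisym_split_le (I I' J K L e : R) : I = J + K -> I' = J + L ->
  I = - I' -> `|K| <= e -> `|L| <= e -> `|I| <= e.
Proof.
by rewrite !ler_norml => ? ? ? /andP[? ?] /andP[? ?]; apply/andP; split; lra.
Qed.

(** [E] contains both halves of the symmetric difference of [S] and its translate, yet its area
    counts once: the two halves bound twice the integral. *)
Lemma antiperiodic_integral_le (u : plane) (S E : set plane) (f : plane -> R) :
  measurable S -> (area S < +oo)%E -> measurable E -> (area E < +oo)%E ->
  measurable_fun setT f -> (forall x, `|f x| <= 1) ->
  (forall x, f (shift2 u x) = - f x) ->
  (forall x, S x <> S (shift2 u x) -> E x) ->
  `|\int[area]_(x in S) f x| <= fine (area E).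
Proof.
move=> mS Soo mE Eoo mf f1 fu SE.
pose S' := shift2 u @^-1` S.
have mS' : measurable S' by rewrite -[S']setTI; apply: measurable_shift2.
have S'oo : (area S' < +oo)%E by rewrite area_shift.
have fle T : measurable T -> (area T < +oo)%E -> area.-integrable T (EFin \o f).
  by move=> mT Too; apply: (integrable_bounded mT Too mf) => x _; exact: f1.
have shiftE : \int[area]_(x in S) f x = - \int[area]_(x in S') f x.
  rewrite (@integral_area_shift _ u) //.
    under eq_Rintegral do rewrite fu -mulN1r.
    by rewrite RintegralZl ?mulN1r //; exact: fle.
  apply: (eq_integrable _ (EFin \o (fun x => - f x))) => //.
    by move=> x _ /=; rewrite fu.
  apply: (integrable_bounded (M := 1)) => //.
    exact: measurable_funN.
  by move=> x _; rewrite normrN.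
have split_int T T' : measurable T -> measurable T' -> (area T < +oo)%E ->
    \int[area]_(x in T) f x =
    \int[area]_(x in T `&` T') f x + \int[area]_(x in T `\` T') f x.
  move=> mT mT' Too; rewrite -Rintegral_setU; first by rewrite setUIDK.
  - exact: measurableI.
  - exact: measurableD.
  - by rewrite setUIDK; exact: fle.
  - by apply/disj_setPS => x [[_ ?] [_]].
have E1 := split_int _ _ mS mS' Soo.
have E2 := split_int _ _ mS' mS S'oo.
have DE : S `\` S' `<=` E by move=> x [Sx nS]; apply: SE => e; apply: nS; rewrite /S' /= -e.
have DE' : S' `\` S `<=` E by move=> x [Sx nS]; apply: SE => e; apply: nS; rewrite e.
have bnd T : measurable T -> T `<=` E -> `|\int[area]_(x in T) f x| <= fine (area E).
  move=> mT TE.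
  have aTE : (area T <= area E)%E by apply: le_measure; rewrite ?inE.
  have Too : (area T < +oo)%E by apply: le_lt_trans aTE Eoo.
  apply: (le_trans (norm_Rintegral_le mT Too mf (fun x _ => f1 x))).
  by rewrite mul1r; apply: fine_le; rewrite ?ge0_fin_numE // measure_ge0.
move: E2; rewrite setIC => E2.
exact: antisym_split_le E1 E2 shiftE
  (bnd _ (measurableD mS mS') DE) (bnd _ (measurableD mS' mS) DE').
Qed.

Lemma array_shape_bounded A : array_shape A ->
  exists2 B : R, 0 < B & forall x, A x -> `|x.1| <= B /\ `|x.2| <= B.
Proof.
move=> [_ [D [_ [M [_ /(_ (`|M| + 1)) DM]] _ [_ AD]]]].
exists (`|M| + 1); first by rewrite ltr_pwDr.
have cB : closed [set x : R * R | `|x| <= `|M| + 1].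
  apply: (closed_comp (f := fun x : R * R => `|x|) (D := [set y | y <= `|M| + 1])).
    by move=> y _; exact: norm_continuous.
  exact: closed_le.
have DB : closure D `<=` [set x : R * R | `|x| <= `|M| + 1].
  rewrite [X in _ `<=` X]((closure_id _).1 cB); apply: closureS => y Dy.
  by apply: DM => //; rewrite ltr_pwDr // ler_norm.
by move=> x /AD/DB /=; rewrite prod_normE ge_max => /andP[].
Qed.

Lemma scale_set_preimage a A : a != 0 ->
  scale_set a A = (fun x : R * R => (a^-1 * x.1, a^-1 * x.2)) @^-1` A.
Proof.
move=> a0; apply/seteqP; split=> [x [y Ay <-]|x Ax] /=.
  by rewrite !mulKf //; case: y Ay.
by exists (a^-1 * x.1, a^-1 * x.2) => //=; rewrite !mulVKf //; case: (x).
Qed.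

Lemma measurable_scale_set a (A : set plane) : a != 0 -> measurable A ->
  measurable (scale_set a A : set plane).
Proof.
move=> a0 mA; rewrite scale_set_preimage // -[X in measurable X]setTI.
suff : measurable_fun setT (fun x : plane => (a^-1 * x.1, a^-1 * x.2) : plane) by apply.
by apply: measurable_fun_pair; apply: measurable_funM.
Qed.

Lemma area_le_box (S : set plane) (r : R) : measurable S -> 0 <= r ->
  (forall x, S x -> `|x.1| <= r /\ `|x.2| <= r) -> (area S <= ((2 * r) ^+ 2)%:E)%E.
Proof.
move=> mS r0 Sr; rewrite -(area_box (0, 0) r0).
apply: le_measure; rewrite ?inE //; first exact: measurable_box.
move=> x /Sr[]; rewrite !ler_norml => /andP[? ?] /andP[? ?].
by split; rewrite /= in_itv /= !add0r; apply/andP; split.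
Qed.

Lemma norm2_ge (x : R * R) : `|x.1| <= norm2 x /\ `|x.2| <= norm2 x.
Proof.
by split; rewrite -sqrtr_sqr ler_sqrt ?addr_ge0 ?sqr_ge0 // ?lerDl ?lerDr sqr_ge0.
Qed.

(** One coordinate of the way back from a boundary crossing, seen in the unscaled shape, to the
    starting point: the covering radius becomes a C / N <= C t, and moving back along the segment
    costs at most one more t. *)
Lemma rescale_interval (a t v s x c : R) (C N : nat) : 0 < a -> `|v| <= t ->
  0 <= s <= 1 -> a / N%:R <= t ->
  c - C%:R / N%:R <= a^-1 * x + s * (a^-1 * v) <= c + C%:R / N%:R ->
  a * c - (C%:R + 1) * t <= x <= a * c + (C%:R + 1) * t.
Proof.
move=> a0 vt /andP[s0 s1] aN /andP[h1 h2].
have CN : C%:R * (a / N%:R) <= C%:R * t by rewrite ler_wpM2l.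
have sv : `|s * v| <= t.
  by rewrite normrM (ger0_norm s0) -[leRHS]mul1r ler_pM.
have e : a * (a^-1 * x + s * (a^-1 * v)) = x + s * v by field; rewrite gt_eqF.
have : a * (c - C%:R / N%:R) <= x + s * v by rewrite -e ler_pM2l.
have : x + s * v <= a * (c + C%:R / N%:R) by rewrite -e ler_pM2l.
rewrite mulrDr mulrBr [a * (_ / _)]mulrCA mulrDl mul1r.
move: CN sv; rewrite ler_norml.
move: (C%:R * (a / N%:R)) (C%:R * t) (s * v) (a * c) => p q w z.
by move=> ? /andP[? ?] ? ?; apply/andP; split; lra.
Qed.

Lemma antiperiodic_array_decay A : array_shape A ->
  exists2 K : R, 0 <= K & forall (a : R) (u : plane) (f : plane -> R),
    0 < a -> 0 < norm2 u -> measurable_fun setT f -> (forall x, `|f x| <= 1) ->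
    (forall x, f (shift2 u x) = - f x) ->
    `|\int[area]_(x in scale_set a A) f x| <= K * (a * norm2 u).
Proof.
move=> sA; have [B B0 AB] := array_shape_bounded sA.
have [mA [D [[oD _ _] _ /piecewise_smooth_coverable[C HC] [DA AD]]]] := sA.
(* First summand: C N squares of side 2 (C + 1) t with N <= 2 a / t. Second summand: the area bound
   (2 a B)^2, which suffices when t > a since then a * a <= a * t. *)
exists (8 * C%:R * (C%:R + 1) ^+ 2 + 4 * B ^+ 2).
  by apply: addr_ge0; apply: mulr_ge0; rewrite ?mulr_ge0 ?exprn_ge0 // ltW.
move=> a u f a0 t0 mf f1 fu; set t := norm2 u in t0 *.
have an0 : a != 0 by rewrite gt_eqF.
have mS := measurable_scale_set an0 mA.
have aB0 : 0 <= a * B by rewrite mulr_ge0 // ltW.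
have aS : (area (scale_set a A) <= ((2 * (a * B)) ^+ 2)%:E)%E.
  apply: area_le_box => // _ [y /AB[y1 y2] <-] /=.
  by rewrite !normrM (gtr0_norm a0) !ler_pM2l.
have Soo : (area (scale_set a A) < +oo)%E by apply: le_lt_trans aS (ltry _).
have CC0 : 0 <= 8 * C%:R * (C%:R + 1) ^+ 2 :> R.
  by apply: mulr_ge0; rewrite ?mulr_ge0 ?exprn_ge0.
have at0 : 0 <= a * t by rewrite mulr_ge0 // ltW.
have [ta|at'] := leP t a; last first.
  apply: (le_trans (norm_Rintegral_le mS Soo mf (fun x _ => f1 x))).
  rewrite mul1r mulrDl (@le_trans _ _ ((2 * (a * B)) ^+ 2)) //.
    by rewrite -lee_fin fineK // ge0_fin_numE.
  rewrite (_ : _ ^+ 2 = 4 * B ^+ 2 * (a * a)); last by ring.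
  apply: ler_wpDl; first exact: mulr_ge0.
  apply: ler_wpM2l; first by rewrite mulr_ge0 ?exprn_ge0 // ltW.
  by rewrite ler_pM2l // ltW.
(* After scaling by [a] the squares should have size about t: this N gives a / N <= t, and t <= a
   keeps it below 2 a / t. *)
pose N := (Num.trunc (a / t)).+1.
have N0 : (0 : R) < N%:R by rewrite ltr0n.
have aN : a / N%:R <= t.
  by rewrite ler_pdivrMr // mulrC -ler_pdivrMr // ltW // truncnS_gt.
have Na : N%:R <= 2 * (a / t).
  have at1 : 1 <= a / t by rewrite ler_pdivlMr // mul1r.
  have : (Num.trunc (a / t))%:R <= a / t by rewrite truncn_le // divr_ge0 // ltW.
  by rewrite /N -natr1; lra.
have [s [ss Hs]] := HC N isT.
have r0 : 0 <= (C%:R + 1) * t by rewrite mulr_ge0 ?addr_ge0 // ltW.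
have [E [mE sE aE]] := boxes_hull [seq (a * c.1, a * c.2) | c <- s] r0.
have Eoo : (area E < +oo)%E by apply: le_lt_trans aE (ltry _).
have SE x : scale_set a A x <> scale_set a A (shift2 u x) -> E x.
  rewrite scale_set_preimage //= => nA.
  rewrite !mulrDr in nA.
  have [s0 s01 /Hs[c cs [b1 b2]]]  :=
    @boundary_crossing R D A (a^-1 * x.1, a^-1 * x.2) (a^-1 * u.1, a^-1 * u.2) oD DA AD nA.
  apply: (sE (a * c.1, a * c.2)); first exact: (map_f (fun c : R * R => (a * c.1, a * c.2))).
  have [u1 u2] := norm2_ge u.
  move: b1 b2; rewrite /= !in_itv /= => b1 b2; split; rewrite /= in_itv /=.
    exact: rescale_interval a0 u1 s01 aN b1.
  exact: rescale_interval a0 u2 s01 aN b2.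
apply: le_trans (antiperiodic_integral_le mS Soo mE Eoo mf f1 fu SE) _.
apply: (@le_trans _ _ ((size s)%:R * (2 * ((C%:R + 1) * t)) ^+ 2)).
  by rewrite -lee_fin fineK ?ge0_fin_numE // (le_trans aE) // size_map.
rewrite [leRHS]mulrDl; apply: ler_wpDr.
  by apply: mulr_ge0; rewrite ?mulr_ge0 ?exprn_ge0 // ltW.
apply: (@le_trans _ _ (C%:R * (2 * (a / t)) * (2 * ((C%:R + 1) * t)) ^+ 2)).
  rewrite ler_wpM2r ?sqr_ge0 // (@le_trans _ _ (C%:R * N%:R)) ?ler_wpM2l //.
  by rewrite -natrM ler_nat.
rewrite le_eqVlt; apply/orP; left; apply/eqP; field.
by rewrite gt_eqF.
Qed.
End Decay.

Section Fourier.
Context {R : realType}.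
Notation plane := (measurableTypeR R * measurableTypeR R)%type.
Notation area := (@area R).

Lemma measurable_cos : measurable_fun setT (@cos R).
Proof. exact: continuous_measurable_fun (@continuous_cos R). Qed.

Lemma measurable_sin : measurable_fun setT (@sin R).
Proof. exact: continuous_measurable_fun (@continuous_sin R). Qed.

Lemma measurable_linear_phase (xi : R * R) :
  measurable_fun setT (fun x : plane => xi.1 * x.1 + xi.2 * x.2).
Proof. by apply: measurable_funD; apply: measurable_funM. Qed.

Lemma norm2Z (r : R) (x : R * R) : norm2 (r * x.1, r * x.2) = `|r| * norm2 x.
Proof. by rewrite /norm2 /= !exprMn -mulrDr sqrtrM ?sqr_ge0 // sqrtr_sqr. Qed.

Lemma array_fourier_decay (A : set (R * R)) : array_shape A ->
  exists2 K : R, 0 <= K & forall (a : R) (xi : R * R), 0 < a -> 0 < norm2 xi ->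
    `|\int[area]_(x in scale_set a A) cos (xi.1 * x.1 + xi.2 * x.2)|
      <= K * (a / norm2 xi) /\
    `|\int[area]_(x in scale_set a A) sin (xi.1 * x.1 + xi.2 * x.2)|
      <= K * (a / norm2 xi).
Proof.
move=> /antiperiodic_array_decay[K K0 HK].
exists (K * pi); first by rewrite mulr_ge0 // pi_ge0.
move=> a xi a0; set n := norm2 xi => n0.
have n2 : xi.1 ^+ 2 + xi.2 ^+ 2 = n ^+ 2 by rewrite /n /norm2 sqr_sqrtr ?addr_ge0 ?sqr_ge0.
pose u : plane := (pi / n ^+ 2 * xi.1, pi / n ^+ 2 * xi.2).
have nu : norm2 u = pi / n.
  rewrite norm2Z -/n ger0_norm; last by rewrite divr_ge0 ?pi_ge0 ?sqr_ge0.
  by field; rewrite gt_eqF.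
have u0 : 0 < norm2 u by rewrite nu divr_gt0 // pi_gt0.
have -> : K * pi * (a / n) = K * (a * norm2 u) by rewrite nu; ring.
have ph x : xi.1 * (shift2 u x).1 + xi.2 * (shift2 u x).2 = xi.1 * x.1 + xi.2 * x.2 + pi.
  rewrite /= (_ : _ + _ = xi.1 * x.1 + xi.2 * x.2 + 
    pi / n ^+ 2 * (xi.1 ^+ 2 + xi.2 ^+ 2)); last by ring.
  by rewrite n2 divfK // expf_neq0 // gt_eqF.
split; apply: HK => //.
- exact: measurableT_comp measurable_cos (measurable_linear_phase xi).
- by move=> x; exact: cos_max.
- by move=> x; rewrite ph cosDpi.
- exact: measurableT_comp measurable_sin (measurable_linear_phase xi).
- by move=> x; exact: sin_max.
- by move=> x; rewrite ph sinDpi.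
Qed.
End Fourier.

(** * Area of the disk *)

Section DiskArea.
Context {R : realType}.
Notation plane := (measurableTypeR R * measurableTypeR R)%type.
Notation area := (@area R).
Notation mu := (@lebesgue_measure R).

Lemma integral_cos2 :
  (\int[mu]_(t in `[(- (pi / 2))%R, (pi / 2)%R]) (cos t ^+ 2)%:E = (pi / 2)%:E)%E.
Proof.
have p0 := @pi_gt0 R.
pose G t : R := (t + sin t * cos t) / 2.
have dF (t : R) : is_derive t (1 : R) G (cos t ^+ 2).
  apply: is_derive_eq.
  rewrite /GRing.scale /=.
  have := cos2sin2 t. nra.
have cF : continuous G.
  by move=> t; apply/differentiable_continuous/derivable1_diffP; apply: ex_derive.
rewrite (@continuous_FTC2 _ (fun t => cos t ^+ 2) G).
- rewrite -EFinB; congr (_%:E); rewrite /G cosN cos_pihalf; lra.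
- lra.
- apply: continuous_subspaceT => t; apply: continuous_comp (@exprn_continuous R 2 _).
  exact: continuous_cos.
- split.
  + by move=> t _; apply: ex_derive.
  + by apply: cvg_at_right_filter; exact: cF.
  + by apply: cvg_at_left_filter; exact: cF.
- by move=> t _; rewrite derive1E derive_val.
Qed.

(** Substitution x = a sin t: cos t >= 0 on the new interval, so the root becomes a cos t and the
    integrand 2 a^2 cos^2 t. *)
Lemma integral_half_disk (a : R) : 0 < a ->
  (\int[mu]_(x in `[(- a)%R, a]) (2 * Num.sqrt (a ^+ 2 - x ^+ 2))%:E = (pi * a ^+ 2)%:E)%E.
Proof.
move=> a0; have p0 := @pi_gt0 R.
pose F t : R := a * sin t.
have dF (t : R) : is_derive t (1 : R) F (a * cos t).
  by apply: is_derive_eq; rewrite /GRing.scale /=; ring.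
have F'E : derive1 F = (fun t => a * cos t).
  by apply/funext => t; rewrite derive1E derive_val.
have cF : continuous F.
  by move=> t; apply/differentiable_continuous/derivable1_diffP; apply: ex_derive.
have cF' : continuous (derive1 F).
  rewrite F'E => t; apply: cvgM; first exact: cvg_cst. exact: continuous_cos.
have -> : `[- a, a]%classic = `[F (- (pi / 2)), F (pi / 2)]%classic.
  by rewrite /F sinN sin_pihalf mulrN mulr1.
rewrite (@integration_by_substitution_increasing _ F).
- transitivity (\int[mu]_(t in `[(- (pi / 2))%R, (pi / 2)%R])
      ((2 * a ^+ 2)%:E * (cos t ^+ 2)%:E))%E.
    apply: eq_integral => t; rewrite inE /= in_itv /= => tpi.
    rewrite F'E -EFinM /F; congr (_%:E).
    rewrite -[LHS]/((2 * Num.sqrt (a ^+ 2 - (a * sin t) ^+ 2)) * (a * cos t)).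
    have -> : a ^+ 2 - (a * sin t) ^+ 2 = (a * cos t) ^+ 2.
      by rewrite !exprMn cos2sin2; ring.
    rewrite sqrtr_sqr ger0_norm; first by ring.
    by rewrite mulr_ge0 ?cos_ge0_pihalf // ltW.
  rewrite ge0_integralZl //=.
  - rewrite integral_cos2 -EFinM; congr (_%:E); by field.
  - apply: measurableT_comp => //; apply: measurable_funTS.
    by apply: measurable_funX; exact: measurable_cos.
  - by move=> t _; rewrite lee_fin sqr_ge0.
  - by rewrite lee_fin mulr_ge0 // sqr_ge0.
- lra.
- move=> x y xI yI xy; rewrite /F ltr_pM2l // ltr_sin //.
- by move=> t _; exact: cF'.
- apply: cvgP; apply: cvg_at_right_filter; exact: cF'.
- apply: cvgP; apply: cvg_at_left_filter; exact: cF'.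
- split.
  + by move=> t _; apply: ex_derive.
  + by apply: cvg_at_right_filter; exact: cF.
  + by apply: cvg_at_left_filter; exact: cF.
- apply: continuous_subspaceT => x; apply: cvgM; first exact: cvg_cst.
  apply: continuous_comp; last exact: sqrt_continuous.
  by apply: cvgB; [exact: cvg_cst|exact: exprn_continuous].
Qed.

Lemma measurable_sqrt : measurable_fun setT (@Num.sqrt R).
Proof. exact: continuous_measurable_fun (@sqrt_continuous R). Qed.

Lemma measurable_disk (a : R) : measurable (disk a : set plane).
Proof.
have -> : (disk a : set plane) = setT `&` (fun x : plane => norm2 x) @^-1` `]-oo, a]%classic.
  by apply/seteqP; split => x /=; rewrite in_itv /= ?andbT // => -[].
have mn : measurable_fun setT (fun x : plane => norm2 x).
  apply: measurableT_comp measurable_sqrt _.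
  by apply: measurable_funD; apply: measurable_funX.
by apply: mn => //.
Qed.

(** The product measure integrates the lengths of the sections, which are segments or empty. *)
Lemma area_disk (a : R) : 0 < a -> area (disk a) = (pi * a ^+ 2)%:E.
Proof.
move=> a0; rewrite -integral_half_disk // integral_mkcond.
rewrite /area /product_measure1; apply: eq_integral => x _.
rewrite /= patchE.
have sec : xsection (disk a) x = [set y | x ^+ 2 + y ^+ 2 <= a ^+ 2].
  apply/seteqP; split => y /=; rewrite /xsection /= inE /disk /= /norm2 /=.
    move=> h; rewrite -[leLHS]sqr_sqrtr ?addr_ge0 ?sqr_ge0 //.
    by rewrite ler_pXn2r // nnegrE ?sqrtr_ge0 // ltW.
  by move=> h; rewrite -[leRHS]gtr0_norm // -sqrtr_sqr ler_sqrt // sqr_ge0.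
rewrite sec; have [h|h] := leP 0 (a ^+ 2 - x ^+ 2).
  set r := Num.sqrt (a ^+ 2 - x ^+ 2).
  have r0 : 0 <= r by exact: sqrtr_ge0.
  have r2 : r ^+ 2 = a ^+ 2 - x ^+ 2 by rewrite sqr_sqrtr.
  have -> : [set y | x ^+ 2 + y ^+ 2 <= a ^+ 2] = `[- r, r]%classic.
    apply/seteqP; split => y /=; 
      by rewrite in_itv /= -ler_norml -[`|_| <= r]ler_sqr ?nnegrE //
        real_normK ?num_real // r2; lra.
  have -> : x \in `[- a, a]%classic.
    rewrite inE /= in_itv /= -ler_norml -ler_sqr ?nnegrE ?(ltW a0) //.
    by rewrite real_normK ?num_real //; lra.
  rewrite lebesgue_measure_itv /= lte_fin.
  by case: ifPn => hr; rewrite -?EFinB; congr (_%:E); lra.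
have -> : [set y | x ^+ 2 + y ^+ 2 <= a ^+ 2] = set0.
  apply/seteqP; split => y //=; have := sqr_ge0 y; lra.
(* Here a^2 - x^2 < 0: the root has its default value 0, so the integrand vanishes whichever branch
   of the restriction is taken. *)
rewrite measure0; case: ifPn => // _.
by rewrite ltr0_sqrtr // mulr0.
Qed.
End DiskArea.

(** * The dyadic Green function near its Fraunhofer limit *)

Section ComplexModulus.
Context {R : realType}.
Notation normc := Normc.normc.
Implicit Types z w : R[i].

Lemma normc_ge0 z : 0 <= normc z.
Proof. by case: z => a b; exact: sqrtr_ge0. Qed.

Lemma ler_normcD z w : normc (z + w) <= normc z + normc w.
Proof. exact: (@le_normcD R z w). Qed.

Lemma normc_conj z : normc (conjc z) = normc z.
Proof. by case: z => a b /=; rewrite sqrrN. Qed.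

Lemma normc_real (x : R) : normc x%:C = `|x|.
Proof. by rewrite /= expr0n addr0 sqrtr_sqr. Qed.

Lemma normc_le_ReIm z : normc z <= `|complex.Re z| + `|complex.Im z|.
Proof.
case: z => a b /=; rewrite -[leRHS]ger0_norm ?addr_ge0 //.
rewrite -sqrtr_sqr ler_sqrt ?sqr_ge0 // sqrrD !real_normK ?num_real //.
by rewrite lerD2r lerDl mulrn_wge0 // mulr_ge0.
Qed.

Lemma Re_le_normc z : `|complex.Re z| <= normc z.
Proof. by case: z => a b /=; rewrite -sqrtr_sqr ler_sqrt ?addr_ge0 ?sqr_ge0 // lerDl sqr_ge0. Qed.

Lemma Im_le_normc z : `|complex.Im z| <= normc z.
Proof. by case: z => a b /=; rewrite -sqrtr_sqr ler_sqrt ?addr_ge0 ?sqr_ge0 // lerDr sqr_ge0. Qed.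

Lemma normc_expi (t : R) : normc (expi t) = 1.
Proof. by rewrite /= cos2Dsin2 sqrtr1. Qed.

Lemma expiD (s t : R) : expi (s + t) = expi s * expi t.
Proof.
rewrite /expi cosD sinD; apply/eqP; rewrite eq_complex /= eqxx /= addrC.
by rewrite mulrC [X in _ + X]mulrC eqxx.
Qed.

Lemma conjc_expi (t : R) : conjc (expi t) = expi (- t).
Proof. by rewrite /expi /= cosN sinN. Qed.

Lemma lipschitz_of_derivative (f f' : R -> R) :
  (forall t : R, is_derive t (1 : R) f (f' t)) -> (forall t, `|f' t| <= 1) ->
  forall s t, `|f s - f t| <= `|s - t|.
Proof.
move=> df f1 s t; wlog ts : s t / t <= s.
  move=> H; case: (leP t s) => [|/ltW] h; first exact: H.
  by rewrite distrC [in leRHS]distrC; exact: H.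
have [|c _ ->] := MVT_segment ts (fun x _ => df x).
- by apply: continuous_subspaceT => x; apply/differentiable_continuous/derivable1_diffP.
- by rewrite normrM -[leRHS]mul1r ler_wpM2r.
Qed.

Lemma expi_lipschitz (s t : R) : normc (expi s - expi t) <= 2 * `|s - t|.
Proof.
apply: (le_trans (normc_le_ReIm _)) => /=.
have hc : `|cos s - cos t| <= `|s - t|.
  apply: (@lipschitz_of_derivative cos (fun t => - sin t)) => u.
  by rewrite normrN sin_max.
have hs : `|sin s - sin t| <= `|s - t|.
  by apply: (@lipschitz_of_derivative sin cos) => u; exact: cos_max.
by rewrite (_ : 2 * _ = `|s - t| + `|s - t|) ?lerD //; ring.
Qed.
End ComplexModulus.

(** * The matrix amplitude and its limit *)

Section Amplitude.
Context {R : realType}.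
Notation normc := Normc.normc.
Implicit Types (x y : R * R) (i j : 'I_3).

(* [amplitude] is the bracket of the dyadic Green function scaled by [Z / r],
   so that it tends to [cross_range_proj]; [w = Z / r], [u] is the unit vector
   along [(x, 0) - (y, Z)]. *)
Definition amplitude (u : 'I_3 -> R) (w : R) (m : R[i]) i j : R[i] :=
  w%:C * ((1 + m) * (i == j)%:R - (1 + 3 * m) * (u i * u j)%:C).

(** The last entry is [- w] because the range part of the difference vector is - Z: the ratio Z / r
    is both the scaling of [amplitude] and, up to sign, a direction cosine. *)
Definition direction (u1 u2 w : R) i : R := nth 0 [:: u1; u2; - w] i.

Lemma cross_range_projE i j :
  @cross_range_proj R i j = ((i == j) && (i < 2)%N)%:R.
Proof.
rewrite /cross_range_proj !mxE.
by case: i => [[|[|[|//]]] Hi]; case: j => [[|[|[|//]]] Hj].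
Qed.

(** Unit length turns the defect of [w] into transverse squares: 1 - w <= 1 - w^2 = u1^2 + u2^2 <= 2
    d. The worst entries are the transverse diagonal ones, such as 1 - w + w u1^2 <= 3 d. *)
Lemma real_amplitude_approx (u1 u2 w d : R) i j : 0 <= w <= 1 ->
  u1 ^+ 2 + u2 ^+ 2 + w ^+ 2 = 1 -> `|u1| <= d -> `|u2| <= d -> d <= 1 ->
  `|w * ((i == j)%:R - direction u1 u2 w i * direction u1 u2 w j)
    - ((i == j) && (i < 2)%N)%:R| <= 3 * d.
Proof.
move=> /andP[w0 w1] uw /[!ler_norml] /andP[a1 a2] /andP[b1 b2] d1.
have q1 : u1 ^+ 2 <= d by nra.
have q2 : u2 ^+ 2 <= d by nra.
have w2 : 1 - w <= u1 ^+ 2 + u2 ^+ 2 by nra.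
have ww : w ^+ 2 <= 1 by nra.
have u12 : u1 * u2 <= d by nra.
have u12' : - d <= u1 * u2 by nra.
by case: i => [[|[|[|//]]] Hi]; case: j => [[|[|[|//]]] Hj]; rewrite /direction /=;
  apply/andP; split; nra.
Qed.

(** The bracket is affine in [m]: its value at m = 0 is the real estimate, and the coefficient w
    (delta_ij - 3 u_i u_j) of [m] has modulus at most 4. *)
Lemma amplitude_approx (u1 u2 w d e : R) (m : R[i]) i j : 0 <= w <= 1 ->
  u1 ^+ 2 + u2 ^+ 2 + w ^+ 2 = 1 -> `|u1| <= d -> `|u2| <= d -> d <= 1 ->
  normc m <= e ->
  normc (amplitude (direction u1 u2 w) w m i j - cross_range_proj i j)
    <= 3 * d + 4 * e.
Proof.
move=> w01 uw u1d u2d d1 me; set u := direction u1 u2 w.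
pose p : R := ((i == j) && (i < 2)%N)%:R.
have -> : amplitude u w m i j - cross_range_proj i j =
    (w * ((i == j)%:R - u i * u j) - p)%:C
    + m * (w * ((i == j)%:R - 3 * (u i * u j)))%:C.
  rewrite cross_range_projE /amplitude /p !(rmorphB, rmorphM, rmorph_nat).
  by ring.
apply: le_trans (ler_normcD _ _) _; apply: lerD.
  by rewrite normc_real; exact: real_amplitude_approx.
rewrite Normc.normcM normc_real mulrC; apply: ler_pM => //; first exact: normc_ge0.
have u1' : `|u1| <= 1 by apply: le_trans u1d _.
have u2' : `|u2| <= 1 by apply: le_trans u2d _.
have ub k : `|u k| <= 1.
  case/andP: w01 => w0 w1.
  by case: k => [[|[|[|//]]] Hk]; rewrite /u /direction //= normrN ger0_norm.
have uu : `|u i * u j| <= 1 by rewrite normrM -[leRHS]mul1r ler_pM.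
have dl : 0 <= ((i == j)%:R : R) <= 1 by case: (_ == _); rewrite ?lexx ?ler01.
move: dl uu w01; move: (u i * u j) ((i == j)%:R : R) => q dlt.
rewrite !ler_norml => /andP[? ?] /andP[? ?] /andP[? ?].
by apply/andP; split; nra.
Qed.

Definition slant (x y : R * R) (Z : R) : R :=
  Num.sqrt ((x.1 - y.1) ^+ 2 + (x.2 - y.2) ^+ 2 + Z ^+ 2).

Lemma slant_sqr x y Z :
  slant x y Z ^+ 2 = (x.1 - y.1) ^+ 2 + (x.2 - y.2) ^+ 2 + Z ^+ 2.
Proof. by rewrite sqr_sqrtr // !addr_ge0 ?sqr_ge0. Qed.

Lemma slant_ge x y Z : 0 <= Z -> Z <= slant x y Z.
Proof.
move=> Z0; rewrite -[leLHS]ger0_norm // -sqrtr_sqr ler_sqrt.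
  by rewrite lerDr addr_ge0 ?sqr_ge0.
by rewrite !addr_ge0 ?sqr_ge0.
Qed.

Definition scaled_green (x y : R * R) (Z k : R) i j : R[i] :=
  let r := slant x y Z in
  amplitude (direction ((x.1 - y.1) / r) ((x.2 - y.2) / r) (Z / r)) (Z / r)
    (greenm (k * r)) i j.

(** The factor Z / r of 1 / (4 pi r) goes into the amplitude; the remaining 1 / (4 pi Z) no longer
    depends on the receiver and can leave the integral over the array. *)
Lemma dyadic_greenE x y (Z k : R) i j : 0 < Z ->
  dyadic_green (Defs.point x 0) (Defs.point y Z) k i j =
  expi (k * slant x y Z) * ((4 * pi * Z)^-1)%:C * scaled_green x y Z k i j.
Proof.
move=> Z0; have r0 : 0 < slant x y Z by apply: lt_le_trans Z0 (slant_ge _ _ (ltW Z0)).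
have eE : enorm (Defs.point x 0 - Defs.point y Z) = slant x y Z.
  rewrite /enorm /slant !big_ord_recr big_ord0 /= !mxE /= add0r.
  by rewrite sub0r sqrrN.
rewrite /dyadic_green /scaled_green !mxE /green eE /amplitude.
set r := slant x y Z in r0 eE *.
have rn0 : r != 0 by rewrite gt_eqF.
rewrite !big_ord_recr big_ord0 /= add0r !mxE /=.
set u := direction _ _ _.
have dE (n : 'I_3) : ([:: x.1; x.2; 0]`_n - [:: y.1; y.2; Z]`_n : R) =
    r * nth 0 [:: (x.1 - y.1) / r; (x.2 - y.2) / r; - (Z / r)] n.
  by case: n => [[|[|[|//]]] Hn] /=; field.
rewrite !dE -/(u i) -/(u j).
have -> : r ^- 2 * (r * u i * (r * u j)) = u i * u j by field.
have -> : (4 * pi * r)%:C^-1 = ((4 * pi * Z)^-1)%:C * (Z / r)%:C :> R[i].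
  rewrite -fmorphV -rmorphM /=; congr (_%:C).
  move: (@pi R) (@pi_gt0 R) => p p0; field.
  by rewrite rn0 !gt_eqF.
by rewrite !mulrA.
Qed.

End Amplitude.

(** * Product of two Green functions: amplitude and linear phase *)

Section Kernel.
Context {R : realType}.
Notation normc := Normc.normc.
Notation P := (@cross_range_proj R).
Implicit Types (x y : R * R) (i j l : 'I_3).

(** For t >= 1 the numerator satisfies |i t - 1| <= t + 1 <= 2 t. *)
Lemma normc_greenm_le (t : R) : 1 <= t -> normc (greenm t) <= 2 / t.
Proof.
move=> t1; have t0 : 0 < t by apply: lt_le_trans t1.
rewrite /greenm Normc.normcM Normc.normcV normc_real ger0_norm ?sqr_ge0 //.
rewrite ler_pdivrMr ?exprn_gt0 //.
have -> : 2 / t * t ^+ 2 = t + t by field; rewrite gt_eqF.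
apply: le_trans (normc_le_ReIm _) _.
by rewrite /= !(mul0r, mulr0, mul1r, subr0, addr0, add0r, sub0r, oppr0) normrN1
   (ger0_norm (ltW t0)) lerD2r.
Qed.

(** [amplitude_approx] with d = s / Z and e = 2 / (k Z): the true distance is at least Z, so putting
    Z in its place only enlarges these bounds. *)
Lemma scaled_green_approx x y (Z k s : R) i j : 0 < Z -> 1 <= k * Z ->
  `|x.1 - y.1| <= s -> `|x.2 - y.2| <= s -> s <= Z ->
  normc (scaled_green x y Z k i j - P i j) <= 3 * (s / Z) + 8 / (k * Z).
Proof.
move=> Z0 kZ s1 s2 sZ.
have Zr := slant_ge x y (ltW Z0); have r0 := lt_le_trans Z0 Zr.
have k0 : 0 < k by rewrite -(pmulr_lgt0 _ Z0) (lt_le_trans _ kZ).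
have kr : k * Z <= k * slant x y Z by rewrite ler_pM2l.
have -> : 8 / (k * Z) = 4 * (2 / (k * Z)) by field; rewrite !gt_eqF.
have ds v : `|v| <= s -> `|v / slant x y Z| <= s / Z.
  move=> vs; rewrite normrM normfV (gtr0_norm r0); apply: ler_pM => //.
    by rewrite invr_ge0 ltW.
  by rewrite lef_pV2.
apply: amplitude_approx.
- by rewrite divr_ge0 ?(ltW Z0) ?(ltW r0) //= ler_pdivrMr // mul1r.
- rewrite !expr_div_n -!mulrDl -slant_sqr divff // expf_neq0 // gt_eqF //.
- exact: ds.
- exact: ds.
- by rewrite ler_pdivrMr // mul1r.
- apply: (le_trans (normc_greenm_le (le_trans kZ kr))).
  by rewrite ler_pM2l // lef_pV2 // posrE ?mulr_gt0.
Qed.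

Lemma normc_proj_le i j : normc (P i j) <= 1.
Proof. by rewrite cross_range_projE; case: (_ && _); rewrite ?Normc.normc1 ?Normc.normc0. Qed.

Lemma proj_idem i l : \sum_j P i j * P j l = P i l.
Proof.
rewrite !big_ord_recr big_ord0 /= !cross_range_projE.
by case: i => [[|[|[|//]]] Hi]; case: l => [[|[|[|//]]] Hl]; 
  rewrite /= ?(mulr0, mul0r, mul1r, addr0, add0r).
Qed.

Lemma normc_sum (I : finType) (f : I -> R[i]) :
  normc (\sum_i f i) <= \sum_i normc (f i).
Proof.
elim/big_ind2: _ => [|a b c d ab cd|//]; first by rewrite Normc.normc0.
by apply: le_trans (ler_normcD _ _) _; exact: lerD.
Qed.

(** The projection is idempotent, so the error telescopes into conj(B - P) B' + P (B' - P). The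
    bound [e <= 11] makes the quadratic part linear: e (1 + e) + e <= 13 e for each of the three
    terms. The value 11 = 3 + 8 fits e = 3 (p + q) / Z + 8 / (k Z) when both ratios are at most
    1. *)
Lemma product_near_proj (B B' : 'I_3 -> 'I_3 -> R[i]) (e : R) i l :
  e <= 11 -> (forall i j, normc (B i j - P i j) <= e) ->
  (forall i j, normc (B' i j - P i j) <= e) ->
  normc (\sum_j conjc (B i j) * B' j l - P i l) <= 39 * e.
Proof.
move=> e11 Be B'e; rewrite -proj_idem -sumrB.
apply: (le_trans (normc_sum _)).
have -> : 39 * e = \sum_(j < 3) 13 * e by rewrite sumr_const card_ord; ring.
apply: ler_sum => j _.
have -> : conjc (B i j) * B' j l - P i j * P j l =
    conjc (B i j - P i j) * B' j l + P i j * (B' j l - P j l).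
  have -> : conjc (B i j - P i j) = conjc (B i j) - P i j.
    by rewrite rmorphB /= cross_range_projE rmorph_nat.
  by ring.
have e0 : 0 <= e by apply: le_trans (normc_ge0 _) (Be i j).
have B'1 : normc (B' j l) <= 1 + e.
  rewrite -[B' j l](subrK (P j l)) addrC; apply: le_trans (ler_normcD _ _) _.
  by apply: lerD; [exact: normc_proj_le|exact: B'e].
apply: le_trans (ler_normcD _ _) _; rewrite !Normc.normcM normc_conj.
have h1 : normc (B i j - P i j) * normc (B' j l) <= e * (1 + e).
  by apply: ler_pM; rewrite ?normc_ge0.
have h2 : normc (P i j) * normc (B' j l - P j l) <= 1 * e.
  by apply: ler_pM; rewrite ?normc_ge0 ?normc_proj_le.
by apply: le_trans (lerD h1 h2) _; nra.
Qed.

(** The difference of the two roots is rationalised: (B - A)(A + B) = B^2 - A^2 = 2 D + e, in which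
    the terms in x alone have cancelled. Replacing A + B by 2 Z then costs products of order (p q +
    q^2) (p + q)^2 / Z^3. *)
Lemma phase_approx x y y' (Z k p q : R) : 0 < Z -> 0 <= k ->
  `|x.1| <= p -> `|x.2| <= p -> `|y.1| <= q -> `|y.2| <= q ->
  `|y'.1| <= q -> `|y'.2| <= q -> p <= Z -> q <= Z ->
  `|k * slant x y' Z - k * slant x y Z
    - k * (x.1 * (y.1 - y'.1) + x.2 * (y.2 - y'.2)) / Z|
  <= 40 * (k * (p ^+ 4 / Z ^+ 3 + q ^+ 2 / Z)).
Proof.
move=> Z0 k0 x1 x2 y1 y2 y'1 y'2 pZ qZ.
have p0 : 0 <= p by apply: le_trans x1.
have q0 : 0 <= q by apply: le_trans y1.
have slant_sub u : `|u.1| <= q -> `|u.2| <= q -> slant x u Z - Z <= (p + q) ^+ 2 / Z.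
  move=> u1 u2; have := slant_ge x u (ltW Z0); have := slant_sqr x u Z.
  have h1 : (x.1 - u.1) ^+ 2 <= (p + q) ^+ 2.
    rewrite -[leLHS]real_normK ?num_real // ler_sqr ?nnegrE ?addr_ge0 //.
    by apply: le_trans (ler_normB _ _) (lerD _ _).
  have h2 : (x.2 - u.2) ^+ 2 <= (p + q) ^+ 2.
    rewrite -[leLHS]real_normK ?num_real // ler_sqr ?nnegrE ?addr_ge0 //.
    by apply: le_trans (ler_normB _ _) (lerD _ _).
  by move=> e h; rewrite ler_pdivlMr //; nra.
set A := slant x y Z; set B := slant x y' Z.
have ZA : Z <= A by apply/slant_ge/ltW.
have ZB : Z <= B by apply/slant_ge/ltW.
have AZ : A - Z <= (p + q) ^+ 2 / Z by apply: slant_sub.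
have BZ : B - Z <= (p + q) ^+ 2 / Z by apply: slant_sub.
set D := x.1 * (y.1 - y'.1) + x.2 * (y.2 - y'.2).
pose e := y'.1 ^+ 2 + y'.2 ^+ 2 - (y.1 ^+ 2 + y.2 ^+ 2).
have BA : (B - A) * (A + B) = 2 * D + e.
  have -> : (B - A) * (A + B) = B ^+ 2 - A ^+ 2 by ring.
  by rewrite /A /B !slant_sqr /D /e; ring.
have D4 : `|D| <= 4 * (p * q).
  have -> : 4 * (p * q) = p * (q + q) + p * (q + q) by ring.
  apply: le_trans (ler_normD _ _) _; rewrite !normrM.
  by apply: lerD; apply: ler_pM => //; apply: le_trans (ler_normB _ _) (lerD _ _).
have sq (v : R) : `|v| <= q -> 0 <= v ^+ 2 <= q ^+ 2.
  by move=> vq; rewrite sqr_ge0 /= -[leLHS]real_normK ?num_real // ler_sqr ?nnegrE.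
have e2 : `|e| <= 2 * q ^+ 2.
  move: (sq _ y1) (sq _ y2) (sq _ y'1) (sq _ y'2); rewrite ler_norml /e.
  move=> /andP[? ?] /andP[? ?] /andP[? ?] /andP[? ?].
  by apply/andP; split; lra.
have AB0 : 0 < A + B by rewrite addr_gt0 // (lt_le_trans Z0).
have -> : k * B - k * A - k * D / Z =
    k * (- ((2 * D + e) * (A + B - 2 * Z) / (2 * Z * (A + B))) + e / (2 * Z)).
  have -> : k * B - k * A = k * ((2 * D + e) / (A + B)) by rewrite -BA mulfK ?gt_eqF // mulrBr.
  by field; rewrite !gt_eqF.
rewrite normrM (ger0_norm k0) mulrCA ler_wpM2l //.
apply: le_trans (ler_normD _ _) _; rewrite normrN.
have h1 : `|e / (2 * Z)| <= q ^+ 2 / Z.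
  rewrite normrM normfV (gtr0_norm (mulr_gt0 _ Z0)) // ler_pdivrMr ?mulr_gt0 //.
  by rewrite (_ : q ^+ 2 / Z * (2 * Z) = 2 * q ^+ 2) //; field; rewrite gt_eqF.
(* The only product without a factor q^2 is p^3 q; it is split by 2 p^3 q <= p^4 + p^2 q^2, the sole
   source of the quartic term in p. The rest carries q^2 and is bounded using p, q <= Z. *)
have poly : (4 * (p * q) + q ^+ 2) * (p + q) ^+ 2 <= 4 * p ^+ 4 + 16 * (q ^+ 2 * Z ^+ 2).
  have t1 : (p + q) ^+ 2 <= 2 * p ^+ 2 + 2 * q ^+ 2.
    by have := sqr_ge0 (p - q); rewrite sqrrB sqrrD; lra.
  have t2 : 0 <= 4 * (p * q) + q ^+ 2 by rewrite addr_ge0 ?sqr_ge0 ?mulr_ge0.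
  have t3 : p * q <= Z ^+ 2 by rewrite expr2 ler_pM.
  have t4 : p ^+ 2 <= Z ^+ 2 by rewrite ler_sqr ?nnegrE // ltW.
  have t5 : q ^+ 2 <= Z ^+ 2 by rewrite ler_sqr ?nnegrE // ltW.
  have t6 := ler_wpM2l t2 t1.
  have t7 := ler_wpM2r (sqr_ge0 q) t3.
  have t8 := ler_wpM2r (sqr_ge0 q) t4.
  have t9 := ler_wpM2r (sqr_ge0 q) t5.
  have t10 := sqr_ge0 (p ^+ 2 - p * q).
  have i1 : (p ^+ 2 - p * q) ^+ 2 = p ^+ 4 - 2 * (p ^+ 3 * q) + p ^+ 2 * q ^+ 2 by ring.
  have i2 : (4 * (p * q) + q ^+ 2) * (2 * p ^+ 2 + 2 * q ^+ 2) =
     8 * (p ^+ 3 * q) + 8 * (p * q * q ^+ 2) +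
       2 * (p ^+ 2 * q ^+ 2) + 2 * (q ^+ 2 * q ^+ 2) by ring.
  rewrite i1 in t10; rewrite i2 in t6; lra.
have h2 : `|(2 * D + e) * (A + B - 2 * Z) / (2 * Z * (A + B))| <=
    4 * (p ^+ 4 / Z ^+ 3) + 16 * (q ^+ 2 / Z).
  have den : 0 < 2 * Z * (A + B) by rewrite !mulr_gt0.
  have num0 : 0 <= A + B - 2 * Z by lra.
  rewrite !normrM normfV (gtr0_norm den) (ger0_norm num0).
  have -> : 4 * (p ^+ 4 / Z ^+ 3) + 16 * (q ^+ 2 / Z) =
      (4 * p ^+ 4 + 16 * (q ^+ 2 * Z ^+ 2)) / Z ^+ 3 by field; rewrite gt_eqF.
  have n1 : `|2 * D + e| <= 2 * (4 * (p * q) + q ^+ 2).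
    apply: le_trans (ler_normD _ _) _; rewrite normrM ger0_norm //; lra.
  have n2 : A + B - 2 * Z <= 2 * ((p + q) ^+ 2 / Z) by lra.
  have n3 : (2 * Z * (A + B))^-1 <= (4 * Z ^+ 2)^-1.
    rewrite lef_pV2 ?posrE ?mulr_gt0 ?exprn_gt0 //; nra.
  have n4 := ler_pM (normr_ge0 _) num0 n1 n2.
  have den' : 0 <= (2 * Z * (A + B))^-1 by rewrite invr_ge0 ltW.
  have n5 := ler_pM (mulr_ge0 (normr_ge0 (2 * D + e)) num0) den' n4 n3.
  apply: (le_trans n5).
  have -> : 2 * (4 * (p * q) + q ^+ 2) * (2 * ((p + q) ^+ 2 / Z)) / (4 * Z ^+ 2) =
    (4 * (p * q) + q ^+ 2) * (p + q) ^+ 2 / Z ^+ 3 by field; rewrite gt_eqF.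
  by rewrite ler_wpM2r // invr_ge0 exprn_ge0 // ltW.
apply: le_trans (lerD h2 h1) _.
have : 0 <= p ^+ 4 / Z ^+ 3 by rewrite divr_ge0 ?exprn_ge0 // ltW.
have : 0 <= q ^+ 2 / Z by rewrite divr_ge0 ?exprn_ge0 // ltW.
by move: (_ / _) (_ / _) => u v; lra.
Qed.


(** [p] bounds the receiver coordinates, [q] those of the two cross-ranges. The summands come from
    the directions, from the term [m], and from the deviation of the phase from its linear part. *)
Definition kernel_error (p q k Z : R) : R :=
  (p + q) / Z + (k * Z)^-1 + k * (p ^+ 4 / Z ^+ 3 + q ^+ 2 / Z).

Lemma kernel_error_ge0 (p q k Z : R) : 0 <= p -> 0 <= q -> 0 < k -> 0 < Z ->
  0 <= kernel_error p q k Z.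
Proof.
move=> p0 q0 k0 Z0; rewrite /kernel_error.
have h1 : 0 <= (p + q) / Z by rewrite divr_ge0 ?addr_ge0 // ltW.
have h2 : 0 <= (k * Z)^-1 by rewrite invr_ge0 mulr_ge0 // ltW.
have h3 : 0 <= p ^+ 4 / Z ^+ 3 by rewrite divr_ge0 ?exprn_ge0 // ltW.
have h4 : 0 <= q ^+ 2 / Z by rewrite divr_ge0 ?exprn_ge0 // ltW.
have h5 : 0 <= k * (p ^+ 4 / Z ^+ 3 + q ^+ 2 / Z).
  by rewrite mulr_ge0 ?addr_ge0 // ltW.
by rewrite !addr_ge0.
Qed.

Lemma conjc_phase_mul (s t v : R) (b b' : R[i]) :
  conjc (expi s * v%:C * b) * (expi t * v%:C * b') =
  (v * v)%:C * expi (t - s) * (conjc b * b').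
Proof.
have -> : conjc (expi s * v%:C * b) = conjc (expi s) * v%:C * conjc b.
  by rewrite -{2}(conjc_real v) -!rmorphM.
rewrite [t - s]addrC expiD -conjc_expi.
have -> : (v * v)%:C = v%:C * v%:C :> R[i] by rewrite -rmorphM.
by move: (conjc _) (conjc b) (v%:C) => ? ? ?; ring.
Qed.

(** Both Green functions have the same prefactor, so only the product of amplitudes and then the
    phase have to be replaced. The coefficients found are 39 * 3 and 39 * 8 from the amplitudes and
    2 * 40 from the phase, all below 400. *)
Lemma kernel_approx x y y' (Z k p q : R) i l : 0 < Z -> 1 <= k * Z ->
  `|x.1| <= p -> `|x.2| <= p -> `|y.1| <= q -> `|y.2| <= q ->
  `|y'.1| <= q -> `|y'.2| <= q -> p + q <= Z ->
  normc (\sum_j conjc (dyadic_green (Defs.point x 0) (Defs.point y Z) k i j)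
           * dyadic_green (Defs.point x 0) (Defs.point y' Z) k j l
         - ((16 * pi ^+ 2 * Z ^+ 2)^-1)%:C
           * expi (k * (x.1 * (y.1 - y'.1) + x.2 * (y.2 - y'.2)) / Z) * P i l)
  <= (16 * pi ^+ 2 * Z ^+ 2)^-1 * (400 * kernel_error p q k Z).
Proof.
move=> Z0 kZ x1 x2 y1 y2 y'1 y'2 pqZ.
have k0 : 0 < k by rewrite -(pmulr_lgt0 _ Z0) (lt_le_trans _ kZ).
have p0 : 0 <= p by apply: le_trans x1.
have q0 : 0 <= q by apply: le_trans y1.
set psi := k * (_ + _) / Z.
have sub v w : `|v| <= p -> `|w| <= q -> `|v - w| <= p + q.
  by move=> vp wq; apply: le_trans (ler_normB _ _) (lerD vp wq).
set c := (16 * pi ^+ 2 * Z ^+ 2)^-1.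
set phi := k * slant x y' Z - k * slant x y Z.
pose S := \sum_j conjc (scaled_green x y Z k i j) * scaled_green x y' Z k j l.
have pi0 := @pi_gt0 R.
have c0 : 0 <= c by rewrite invr_ge0 mulr_ge0 ?exprn_ge0 ?(ltW Z0) // mulr_ge0 ?exprn_ge0 // ltW.
have -> : \sum_j conjc (dyadic_green (Defs.point x 0) (Defs.point y Z) k i j)
    * dyadic_green (Defs.point x 0) (Defs.point y' Z) k j l = c%:C * expi phi * S.
  have -> : c = (4 * pi * Z)^-1 * (4 * pi * Z)^-1.
    by rewrite /c -invfM; congr (_^-1); ring.
  rewrite /S /phi mulr_sumr; apply: eq_bigr => j _.
  rewrite -conjc_phase_mul; congr (conjc _ * _); exact: dyadic_greenE.
have -> : c%:C * expi phi * S - c%:C * expi psi * P i l =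
    c%:C * (expi phi * (S - P i l) + (expi phi - expi psi) * P i l) by ring.
rewrite Normc.normcM normc_real ger0_norm // ler_wpM2l //.
set e := 3 * ((p + q) / Z) + 8 / (k * Z).
have pqZ1 : (p + q) / Z <= 1 by rewrite ler_pdivrMr // mul1r.
have kZ1 : (k * Z)^-1 <= 1 by rewrite invf_le1 // mulr_gt0.
have Sle : normc (S - P i l) <= 39 * e.
  apply: product_near_proj; first by rewrite /e; lra.
    by move=> ? ?; apply: scaled_green_approx => //; apply: sub.
  by move=> ? ?; apply: scaled_green_approx => //; apply: sub.
have Ple : `|phi - psi| <= 40 * (k * (p ^+ 4 / Z ^+ 3 + q ^+ 2 / Z)).
  apply: phase_approx => //; first exact: ltW.
    by apply: le_trans pqZ; rewrite lerDl.
  by apply: le_trans pqZ; rewrite lerDr.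
apply: le_trans (ler_normcD _ _) _; rewrite !Normc.normcM normc_expi mul1r.
have h : normc (expi phi - expi psi) * normc (P i l) <= 2 * `|phi - psi| * 1.
  by apply: ler_pM; rewrite ?normc_ge0 ?normc_proj_le ?expi_lipschitz.
apply: le_trans (lerD Sle h) _; rewrite /kernel_error /e.
have : 0 <= (p + q) / Z by rewrite divr_ge0 ?addr_ge0 // ltW.
have : 0 <= (k * Z)^-1 by rewrite invr_ge0 mulr_ge0 // ltW.
have : 0 <= k * (p ^+ 4 / Z ^+ 3 + q ^+ 2 / Z).
  by rewrite mulr_ge0 ?addr_ge0 ?divr_ge0 ?exprn_ge0 // ltW.
move: Ple; move: (k * (_ + _)) (`|_|) ((k * Z)^-1) ((p + q) / Z) => u1 u2 u3 u4.
by lra.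
Qed.
End Kernel.

(** * Complex-valued integrals *)

Section ComplexIntegral.
Context d (X : measurableType d) {R : realType}.
Variable m : {measure set X -> \bar R}.
Notation normc := Normc.normc.
Implicit Types (f g : X -> R[i]) (S : set X).

Definition cmeasurable f :=
  measurable_fun setT (fun x => complex.Re (f x)) /\
  measurable_fun setT (fun x => complex.Im (f x)).

(** Defined by parts, in the form that [integral_vec] has in each coordinate. *)
Definition cintegral S f : R[i] :=
  (\int[m]_(x in S) complex.Re (f x)) +i* (\int[m]_(x in S) complex.Im (f x)).

Lemma cmeasurable_cst (z : R[i]) : cmeasurable (fun=> z).
Proof. by split; exact: measurable_cst. Qed.

Lemma cmeasurable_real (f : X -> R) : measurable_fun setT f ->
  cmeasurable (fun x => (f x)%:C).
Proof. by move=> mf; split => //=; exact: measurable_cst. Qed.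

Lemma cmeasurableD f g : cmeasurable f -> cmeasurable g ->
  cmeasurable (fun x => f x + g x).
Proof.
move=> [f1 f2] [g1 g2]; split.
- rewrite (_ : (fun x => _) = (fun x => complex.Re (f x)) \+ (fun x => complex.Re (g x))).
    exact: measurable_funD.
  by apply/funext => x /=; case: (f x) (g x) => [? ?] [? ?].
- rewrite (_ : (fun x => _) = (fun x => complex.Im (f x)) \+ (fun x => complex.Im (g x))).
    exact: measurable_funD.
  by apply/funext => x /=; case: (f x) (g x) => [? ?] [? ?].
Qed.

Lemma cmeasurableM f g : cmeasurable f -> cmeasurable g ->
  cmeasurable (fun x => f x * g x).
Proof.
move=> [f1 f2] [g1 g2]; split.
- rewrite (_ : (fun x => _) = (fun x => complex.Re (f x)) \* (fun x => complex.Re (g x))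
     \- (fun x => complex.Im (f x)) \* (fun x => complex.Im (g x))).
    by apply: measurable_funB; exact: measurable_funM.
  by apply/funext => x /=; case: (f x) (g x) => [? ?] [? ?].
- rewrite (_ : (fun x => _) = (fun x => complex.Re (f x)) \* (fun x => complex.Im (g x))
     \+ (fun x => complex.Im (f x)) \* (fun x => complex.Re (g x))).
    by apply: measurable_funD; exact: measurable_funM.
  by apply/funext => x /=; case: (f x) (g x) => [? ?] [? ?].
Qed.

Lemma cmeasurableN f : cmeasurable f -> cmeasurable (fun x => - f x).
Proof.
move=> mf; rewrite (_ : (fun x => _) = (fun x => (-1) * f x)).
  by apply: cmeasurableM => //; exact: cmeasurable_cst.
by apply/funext => x; rewrite mulN1r.
Qed.

Lemma cmeasurableB f g : cmeasurable f -> cmeasurable g ->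
  cmeasurable (fun x => f x - g x).
Proof. by move=> mf mg; apply: cmeasurableD => //; exact: cmeasurableN. Qed.

Lemma cmeasurable_conj f : cmeasurable f -> cmeasurable (fun x => conjc (f x)).
Proof.
move=> [f1 f2]; split.
- by rewrite (_ : (fun x => _) = (fun x => complex.Re (f x))) //; apply/funext => x /=; case: (f x).
- rewrite (_ : (fun x => _) = \- (fun x => complex.Im (f x))).
    exact: measurable_funN.
  by apply/funext => x /=; case: (f x).
Qed.

Lemma cmeasurable_sum (I : finType) (F : I -> X -> R[i]) :
  (forall i, cmeasurable (F i)) -> cmeasurable (fun x => \sum_i F i x).
Proof.
move=> mF; rewrite unlock; elim: (index_enum I) => [|i s IH] /=.
  exact: cmeasurable_cst.
exact: cmeasurableD.
Qed.

Lemma cmeasurable_expi (f : X -> R) : measurable_fun setT f ->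
  cmeasurable (fun x => expi (f x)).
Proof.
move=> mf; split => /=; [exact: measurableT_comp measurable_cos mf|].
exact: measurableT_comp measurable_sin mf.
Qed.

(** On nonnegative reals, 0 included, inversion is the real power of exponent -1, and real powers
    are measurable. *)
Lemma measurable_inv (f : X -> R) : (forall x, 0 <= f x) ->
  measurable_fun setT f -> measurable_fun setT (fun x => (f x)^-1).
Proof.
move=> f0 mf; rewrite (_ : (fun x => _) = (@powR R ^~ (-1)) \o f).
  exact: measurableT_comp (measurable_powR _) mf.
by apply/funext => x /=; rewrite powR_inv1.
Qed.

Lemma cintegral_integrable S f (B : R) : measurable S -> (m S < +oo)%E ->
  cmeasurable f -> (forall x, S x -> normc (f x) <= B) ->
  m.-integrable S (EFin \o (fun x => complex.Re (f x))) /\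
  m.-integrable S (EFin \o (fun x => complex.Im (f x))).
Proof.
move=> mS Soo [m1 m2] fB; split.
- apply: (integrable_bounded mS Soo m1) => x /fB; apply: le_trans.
  exact: Re_le_normc.
- apply: (integrable_bounded mS Soo m2) => x /fB; apply: le_trans.
  exact: Im_le_normc.
Qed.

Lemma normc_cintegral_le S f (B : R) : measurable S -> (m S < +oo)%E ->
  cmeasurable f -> (forall x, S x -> normc (f x) <= B) ->
  normc (cintegral S f) <= 2 * B * fine (m S).
Proof.
move=> mS Soo [m1 m2] fB; apply: (le_trans (normc_le_ReIm _)) => /=.
have -> : 2 * B * fine (m S) = B * fine (m S) + B * fine (m S) by ring.
apply: lerD; apply: norm_Rintegral_le => // x /fB; apply: le_trans.
- exact: Re_le_normc.
- exact: Im_le_normc.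
Qed.

Lemma cintegralB S f g (B B' : R) : measurable S -> (m S < +oo)%E ->
  cmeasurable f -> cmeasurable g -> (forall x, S x -> normc (f x) <= B) ->
  (forall x, S x -> normc (g x) <= B') ->
  cintegral S (fun x => f x - g x) = cintegral S f - cintegral S g.
Proof.
move=> mS Soo mf mg fB gB'.
have [f1 f2] := cintegral_integrable mS Soo mf fB.
have [g1 g2] := cintegral_integrable mS Soo mg gB'.
rewrite /cintegral -[RHS]/((_ - _) +i* (_ - _)) -!RintegralB //.
by congr (_ +i* _); apply: eq_Rintegral => x _; case: (f x) (g x) => [? ?] [? ?].
Qed.

Lemma cintegralZl S f (z : R[i]) (B : R) : measurable S -> (m S < +oo)%E ->
  cmeasurable f -> (forall x, S x -> normc (f x) <= B) ->
  cintegral S (fun x => z * f x) = z * cintegral S f.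
Proof.
move=> mS Soo mf fB; have [f1 f2] := cintegral_integrable mS Soo mf fB.
case: z => a b; rewrite /cintegral.
rewrite -[RHS]/((a * _ - b * _) +i* (a * _ + b * _)).
have Zi c h : m.-integrable S (EFin \o h) -> m.-integrable S (EFin \o (fun x => c * h x)).
  move=> hi; apply: (eq_integrable mS (fun x => c%:E * (EFin \o h) x)%E).
    by move=> x _ /=; rewrite EFinM.
  exact: integrableZl.
rewrite -!RintegralZl // -RintegralB ?Zi // -RintegralD ?Zi //.
by congr (_ +i* _); apply: eq_Rintegral => x _; case: (f x) => [? ?].
Qed.
End ComplexIntegral.

(** * The Kirchhoff image *)

Section Image.
Context {R : realType}.
Notation normc := Normc.normc.
Notation plane := (measurableTypeR R * measurableTypeR R)%type.
Notation area := (@area R).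
Notation P := (@cross_range_proj R).
Notation cmeas f := (cmeasurable (X := plane) f).
Implicit Types (y : R * R) (i j l : 'I_3).

Lemma measurable_slant y (Z : R) :
  measurable_fun setT (fun x : plane => slant x y Z).
Proof.
apply: measurableT_comp measurable_sqrt _.
by apply: measurable_funD => //; apply: measurable_funD; apply: measurable_funX;
  apply: measurable_funB.
Qed.

Lemma slant_ge0 (x y : R * R) (Z : R) : 0 <= slant x y Z.
Proof. exact: sqrtr_ge0. Qed.

Lemma measurable_div_slant y (Z : R) (f : plane -> R) : measurable_fun setT f ->
  measurable_fun setT (fun x : plane => f x / slant x y Z).
Proof.
move=> mf; apply: measurable_funM => //; apply: measurable_inv.
  by move=> x; exact: slant_ge0.
exact: measurable_slant.
Qed.

Lemma measurable_direction y (Z : R) i :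
  measurable_fun setT (fun x : plane =>
    direction ((x.1 - y.1) / slant x y Z) ((x.2 - y.2) / slant x y Z) (Z / slant x y Z) i).
Proof.
case: i => [[|[|[|//]]] Hi]; rewrite /direction /=.
- by apply: measurable_div_slant; apply: measurable_funB.
- by apply: measurable_div_slant; apply: measurable_funB.
- by apply: measurable_funN; apply: measurable_div_slant.
Qed.

Lemma cmeasurable_dyadic_green y (Z k : R) i j : 0 < Z -> 0 < k ->
  cmeas (fun x => dyadic_green (Defs.point x 0) (Defs.point y Z) k i j).
Proof.
move=> Z0 k0.
rewrite (_ : (fun x => _) = fun x => expi (k * slant x y Z) * ((4 * pi * Z)^-1)%:C
    * scaled_green x y Z k i j); last first.
  by apply/funext => x; exact: dyadic_greenE.
have ms := measurable_slant y Z.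
have mks : measurable_fun setT (fun x : plane => k * slant x y Z).
  by apply: measurable_funM.
have mm : cmeas (fun x => greenm (k * slant x y Z)).
  rewrite (_ : (fun x => _) = fun x => ('i * (k * slant x y Z)%:C - 1)
     * (((k * slant x y Z) ^+ 2)^-1)%:C); last first.
    by apply/funext => x; rewrite /greenm -fmorphV.
  apply: cmeasurableM.
    apply: cmeasurableB; last exact: cmeasurable_cst.
    apply: cmeasurableM; first exact: cmeasurable_cst.
    exact: cmeasurable_real.
  apply: cmeasurable_real; apply: measurable_inv; first by move=> x; exact: sqr_ge0.
  exact: measurable_funX.
apply: cmeasurableM.
  apply: cmeasurableM; last exact: cmeasurable_cst.
  exact: cmeasurable_expi.
rewrite /scaled_green /amplitude; apply: cmeasurableM.
  by apply: cmeasurable_real; apply: measurable_div_slant.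
apply: cmeasurableB.
  apply: cmeasurableM; last exact: cmeasurable_cst.
  by apply: cmeasurableD => //; exact: cmeasurable_cst.
apply: cmeasurableM.
  apply: cmeasurableD; first exact: cmeasurable_cst.
  by apply: cmeasurableM => //; exact: cmeasurable_cst.
apply: cmeasurable_real; apply: measurable_funM; exact: measurable_direction.
Qed.

Definition kernel y y' (Z k : R) i l (x : plane) : R[i] :=
  \sum_j conjc (dyadic_green (Defs.point x 0) (Defs.point y Z) k i j)
    * dyadic_green (Defs.point x 0) (Defs.point y' Z) k j l.

Lemma cmeasurable_kernel y y' (Z k : R) i l : 0 < Z -> 0 < k ->
  cmeas (kernel y y' Z k i l).
Proof.
move=> Z0 k0; apply: cmeasurable_sum => j.
by apply: cmeasurableM; [apply: cmeasurable_conj|]; exact: cmeasurable_dyadic_green.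
Qed.

Lemma kirchhoff_integrand y y' (Z k mu omega : R) (p : 'cV[R[i]]_3) (x : plane) i :
  (conj_mx (dyadic_green (Defs.point x 0) (Defs.point y Z) k)
    *m dipole_data mu omega k (Defs.point y' Z) p x) i 0 =
  (mu * omega ^+ 2)%:C * \sum_l kernel y y' Z k i l x * p l 0.
Proof.
rewrite /dipole_data -scalemxAr mulmxA [LHS]mxE [X in _ * X = _]mxE.
congr (_ * _); apply: eq_bigr => l _.
rewrite [X in X * _]mxE; congr (_ * _); apply: eq_bigr => j _.
by rewrite [X in X * _]mxE.
Qed.

Definition cross_phase y y' (Z k : R) (x : plane) : R :=
  k * (x.1 * (y.1 - y'.1) + x.2 * (y.2 - y'.2)) / Z.

Lemma measurable_cross_phase y y' (Z k : R) :
  measurable_fun setT (cross_phase y y' Z k).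
Proof.
apply: measurable_funM => //; apply: measurable_funM => //.
by apply: measurable_funD; apply: measurable_funM.
Qed.

(** The array enters only through its size [p] and its area, so one constant serves every shape and
    both halves of the theorem. The factor [mu * omega ^+ 2] of the data cancels against its
    inverse. *)
Lemma kirchhoff_approx : exists2 W : R, 0 <= W &
  forall (S : set plane) y y' (Z k mu omega p q M : R) (pol : 'cV[R[i]]_3) i,
  measurable S -> (area S < +oo)%E ->
  (forall x, S x -> `|x.1| <= p /\ `|x.2| <= p) ->
  `|y.1| <= q -> `|y.2| <= q -> `|y'.1| <= q -> `|y'.2| <= q ->
  0 < Z -> 1 <= k * Z -> p + q <= Z -> 0 <= p ->
  0 < mu -> 0 < omega -> (forall l, normc (pol l 0) <= M) ->
  normc (kirchhoff mu omega k S
           (dipole_data mu omega k (Defs.point y' Z) pol) (Defs.point y Z) i 0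
         - ((16 * pi ^+ 2 * Z ^+ 2)^-1)%:C * (P *m pol) i 0
           * cintegral area S (fun x => expi (cross_phase y y' Z k x)))
  <= W * M * (16 * pi ^+ 2 * Z ^+ 2)^-1 * kernel_error p q k Z * fine (area S).
Proof.
(* 400 from each kernel entry, 3 for the components of the polarization, 2 for bounding real and
   imaginary parts of the integral separately. *)
exists (2 * (3 * 400)); first by do 2!apply: mulr_ge0 (ler0n _ _) _; exact: ler0n.
move=> S y y' Z k mu omega p q M pol i mS Soo Sp y1 y2 y'1 y'2 Z0 kZ pqZ p0 mu0 om0 polM.
have k0 : 0 < k by rewrite -(pmulr_lgt0 _ Z0) (lt_le_trans _ kZ).
have q0 : 0 <= q by apply: le_trans y1.
have M0 : 0 <= M by apply: le_trans (polM 0); exact: normc_ge0.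
set c := (16 * pi ^+ 2 * Z ^+ 2)^-1.
have c0 : 0 <= c.
  by rewrite invr_ge0 mulr_ge0 ?exprn_ge0 ?(ltW Z0) // mulr_ge0 ?exprn_ge0 // pi_ge0.
set err := kernel_error p q k Z.
have err0 : 0 <= err by exact: kernel_error_ge0.
pose e x := expi (cross_phase y y' Z k x).
have me : cmeas e by apply: cmeasurable_expi; exact: measurable_cross_phase.
pose g x := \sum_l kernel y y' Z k i l x * pol l 0.
pose h x := c%:C * (P *m pol) i 0 * e x.
have mg : cmeas g.
  apply: cmeasurable_sum => l; apply: cmeasurableM; last exact: cmeasurable_cst.
  exact: cmeasurable_kernel.
have mh : cmeas h by apply: cmeasurableM => //; exact: cmeasurable_cst.
have gh x : S x -> normc (g x - h x) <= 3 * 400 * M * c * err.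
  move=> /Sp[x1 x2]; rewrite /g /h mxE mulr_sumr mulr_suml -sumrB.
  apply: le_trans (normc_sum _) _.
  have -> : 3 * 400 * M * c * err = \sum_(l < 3) c * (400 * err) * M.
    by rewrite sumr_const card_ord; ring.
  apply: ler_sum => l _.
  have -> : kernel y y' Z k i l x * pol l 0 - c%:C * (P i l * pol l 0) * e x =
     (kernel y y' Z k i l x - c%:C * e x * P i l) * pol l 0 by ring.
  rewrite Normc.normcM; apply: ler_pM; rewrite ?normc_ge0 //.
  exact: kernel_approx.
have hB x : S x -> normc (h x) <= normc (c%:C * (P *m pol) i 0).
  by move=> _; rewrite /h Normc.normcM normc_expi mulr1.
pose B := normc (c%:C * (P *m pol) i 0) + 3 * 400 * M * c * err.
have gB x : S x -> normc (g x) <= B.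
  move=> Sx; rewrite -[g x](subrK (h x)) addrC.
  by apply: le_trans (ler_normcD _ _) (lerD (hB x Sx) (gh x Sx)).
set D := mu * omega ^+ 2.
have D0 : D != 0 by rewrite gt_eqF // mulr_gt0 // exprn_gt0.
have -> : kirchhoff mu omega k S (dipole_data mu omega k (Defs.point y' Z) pol)
    (Defs.point y Z) i 0 = cintegral area S g.
  rewrite /kirchhoff /integral_vec !mxE -/D.
  transitivity ((D^-1)%:C * cintegral area S (fun x => D%:C * g x)).
    congr (_ * (_ +i* _)); apply: eq_Rintegral => x _;
    by rewrite kirchhoff_integrand.
  rewrite (cintegralZl D%:C mS Soo mg gB) mulrA -rmorphM /= mulVf //.
  by rewrite mul1r.
have -> : c%:C * (P *m pol) i 0 * cintegral area S (fun x => expi (cross_phase y y' Z k x))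
    = cintegral area S h.
  rewrite (@cintegralZl _ _ _ area S e _ 1 mS Soo me) // => x _.
  by rewrite normc_expi.
rewrite -(cintegralB mS Soo mg mh gB hB).
apply: le_trans (normc_cintegral_le mS Soo (cmeasurableB mg mh) gh) _.
by rewrite le_eqVlt; apply/orP; left; apply/eqP; ring.
Qed.
End Image.

(** * Comparison of the error terms *)

Section Regime.
Context {R : realType}.
Implicit Types k L a b Z : R.

(** This is a^2 Theta_a / L^2 at one value of the parameters; it equals k a^4 / L^3, the quartic
    phase error. *)
Definition aperture_term k L a : R := a ^+ 2 * (k * a ^+ 2 / L) / L ^+ 2.

(** By Z >= L / 2, each power of 1 / Z costs a factor 2; the constant is the sum of the five
    resulting coefficients and so dominates each of them. *)
Lemma kernel_error_le k L a b Z (B M : R) : 0 < k -> 0 < L -> 0 < a -> 0 < b ->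
  0 < B -> 0 < M -> L / 2 <= Z ->
  kernel_error (B * a) (M * b) k Z <=
  (2 * B + 2 * M + 2 + 8 * B ^+ 4 + 2 * M ^+ 2) *
  (a / L + b / L + (k * L)^-1 + aperture_term k L a + k * b ^+ 2 / L).
Proof.
move=> k0 L0 a0 b0 B0 M0 LZ.
have L2 : 0 < L / 2 by rewrite divr_gt0.
have Z0 : 0 < Z by apply: lt_le_trans LZ.
have iZ : Z^-1 <= 2 / L.
  by rewrite -[2 / L]invf_div lef_pV2 // posrE.
have iZ0 : 0 <= Z^-1 by rewrite invr_ge0 ltW.
have iZ3 : (Z ^+ 3)^-1 <= 8 / L ^+ 3.
  rewrite -exprVn (_ : 8 / L ^+ 3 = (2 / L) ^+ 3); last by field; rewrite gt_eqF.
  by rewrite lerXn2r // nnegrE // divr_ge0 // ltW.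
have h1 : (B * a + M * b) / Z <= (B * a + M * b) * (2 / L).
  by rewrite ler_wpM2l // addr_ge0 // mulr_ge0 // ltW.
have h2 : (k * Z)^-1 <= 2 * (k * L)^-1.
  rewrite !invfM (_ : 2 * _ = k^-1 * (2 / L)); last by ring.
  by rewrite ler_wpM2l // invr_ge0 ltW.
have h3 : k * ((B * a) ^+ 4 / Z ^+ 3 + (M * b) ^+ 2 / Z) <=
  k * ((B * a) ^+ 4 * (8 / L ^+ 3) + (M * b) ^+ 2 * (2 / L)).
  rewrite ler_pM2l //; apply: lerD; rewrite ler_wpM2l // exprn_ge0 // mulr_ge0 // ltW //.
rewrite /kernel_error; apply: le_trans (lerD (lerD h1 h2) h3) _.
have -> : (B * a + M * b) * (2 / L) + 2 * (k * L)^-1 +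
   k * ((B * a) ^+ 4 * (8 / L ^+ 3) + (M * b) ^+ 2 * (2 / L)) =
  2 * B * (a / L) + 2 * M * (b / L) + 2 * (k * L)^-1 +
   8 * B ^+ 4 * aperture_term k L a + 2 * M ^+ 2 * (k * b ^+ 2 / L).
  by rewrite /aperture_term; field; rewrite !gt_eqF.
have : 0 <= a / L by rewrite divr_ge0 // ltW.
have : 0 <= b / L by rewrite divr_ge0 // ltW.
have : 0 <= (k * L)^-1 by rewrite invr_ge0 mulr_ge0 // ltW.
have : 0 <= aperture_term k L a.
  by rewrite /aperture_term !mulr_ge0 ?invr_ge0 ?exprn_ge0 // ltW.
have : 0 <= k * b ^+ 2 / L by rewrite !mulr_ge0 ?invr_ge0 ?exprn_ge0 // ltW.
have : 0 <= B ^+ 4 by rewrite exprn_ge0 // ltW.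
have : 0 <= M ^+ 2 by rewrite exprn_ge0 // ltW.
move: (aperture_term _ _ _) (k * b ^+ 2 / L) (k * L)^-1 (a / L) (b / L) (B ^+ 4) (M ^+ 2).
move=> u1 u2 u3 u4 u5 u6 u7 ? ? ? ? ? ? ?.
set C := 2 * B + _ + _ + _ + _.
have CB : 2 * B <= C by rewrite /C; lra.
have CM : 2 * M <= C by rewrite /C; lra.
have C2 : 2 <= C by rewrite /C; lra.
have C8 : 8 * u6 <= C by rewrite /C; lra.
have C7 : 2 * u7 <= C by rewrite /C; lra.
by rewrite !mulrDr; do ![apply: lerD]; apply: ler_wpM2r.
Qed.

(* With [al = a / L], [be = b / L], [ka = k L], the first order error of the
   amplitude is dominated by the three error terms of the theorem: if
   [ka al^3 < 1] and [ka be^2 < al] then [(al ka be)^2 < ka al^3 < 1]. *)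
Lemma amplitude_error_absorbed (al be ka : R) : 0 < al <= 1 -> 0 < be <= 1 -> 0 < ka ->
  al + be + ka^-1 <= 3 * ((al * ka * be)^-1 + ka * al ^+ 4 + ka * be ^+ 2).
Proof.
move=> /andP[al0 al1] /andP[be0 be1] ka0.
have T0 : 0 < al * ka * be by rewrite !mulr_gt0.
have E2 : 0 <= ka * al ^+ 4 by rewrite mulr_ge0 ?exprn_ge0 // ltW.
have E3 : 0 <= ka * be ^+ 2 by rewrite mulr_ge0 ?exprn_ge0 // ltW.
have T1 : 0 <= (al * ka * be)^-1 by rewrite invr_ge0 ltW.
have inv1 : al * ka * be <= 1 -> 1 <= (al * ka * be)^-1.
  by move=> h; rewrite invf_ge1.
have h1 : al <= (al * ka * be)^-1 + ka * al ^+ 4 + ka * be ^+ 2.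
  have [c1|c1] := leP 1 (ka * al ^+ 3).
    have : al <= ka * al ^+ 4.
      by rewrite exprSr mulrA -[leLHS]mul1r ler_pM2r.
    lra.
  have [c2|c2] := leP al (ka * be ^+ 2); first lra.
  have : (al * ka * be) ^+ 2 <= 1 ^+ 2.
    rewrite expr1n; apply: le_trans (ltW c1).
    have -> : (al * ka * be) ^+ 2 = al ^+ 2 * ka * (ka * be ^+ 2) by ring.
    have -> : ka * al ^+ 3 = al ^+ 2 * ka * al by ring.
    by rewrite ler_pM2l ?mulr_gt0 ?exprn_gt0 // ltW.
  rewrite ler_sqr ?nnegrE ?(ltW T0) // => /inv1; lra.
have h2 : be <= (al * ka * be)^-1 + ka * al ^+ 4 + ka * be ^+ 2.
  have [c1|c1] := leP 1 (ka * be).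
    have : be <= ka * be ^+ 2.
      by rewrite expr2 mulrA -[leLHS]mul1r ler_pM2r.
    lra.
  have : al * ka * be <= 1.
    rewrite -mulrA -[leRHS]mul1r; apply: ler_pM => //; rewrite ltW // mulr_gt0 //.
  by move=> /inv1; lra.
have h3 : ka^-1 <= (al * ka * be)^-1 + ka * al ^+ 4 + ka * be ^+ 2.
  have : ka^-1 <= (al * ka * be)^-1.
    rewrite lef_pV2 ?posrE // mulrAC -[leRHS]mul1r ler_pM2r //.
    by rewrite -[leRHS]mul1r ler_pM // ltW.
  lra.
by lra.
Qed.

(** A separation of at most r b makes L / (a k D) at least 1 / r times the inverse of (a / L) (k L)
    (b / L), so [amplitude_error_absorbed] applies with its factor 3. The last two terms already
    stand on the left, hence 4 = 3 + 1. *)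
Lemma error_absorbed k L a b (r D : R) : 0 < k -> 0 < L -> 0 < a -> 0 < b ->
  a <= L -> b <= L -> 0 < r -> 0 < D -> D <= r * b ->
  a / L + b / L + (k * L)^-1 + aperture_term k L a + k * b ^+ 2 / L <=
  (3 * r + 4) * (L / (a * k * D) + aperture_term k L a + k * b ^+ 2 / L).
Proof.
move=> k0 L0 a0 b0 aL bL r0 D0 Drb.
have al : 0 < a / L <= 1 by rewrite divr_gt0 //= ler_pdivrMr // mul1r.
have be : 0 < b / L <= 1 by rewrite divr_gt0 //= ler_pdivrMr // mul1r.
have := amplitude_error_absorbed al be (mulr_gt0 k0 L0).
have -> : (a / L * (k * L) * (b / L))^-1 = r * (L / (a * k * (r * b))).
  by field; rewrite !gt_eqF.
have -> : k * L * (a / L) ^+ 4 = aperture_term k L a.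
  by rewrite /aperture_term; field; rewrite gt_eqF.
have -> : k * L * (b / L) ^+ 2 = k * b ^+ 2 / L by field; rewrite gt_eqF.
have : L / (a * k * (r * b)) <= L / (a * k * D).
  by rewrite ler_pM2l // lef_pV2 ?posrE ?mulr_gt0 // ler_pM2l // mulr_gt0.
have : 0 <= aperture_term k L a.
  by rewrite /aperture_term !mulr_ge0 ?invr_ge0 ?exprn_ge0 // ltW.
have : 0 <= k * b ^+ 2 / L by rewrite !mulr_ge0 ?invr_ge0 ?exprn_ge0 // ltW.
have : 0 <= L / (a * k * D) by rewrite divr_ge0 ?mulr_ge0 // ltW.
move: (L / _) (aperture_term _ _ _) (k * b ^+ 2 / L) (k * L)^-1 (a / L) (b / L) (L / _).
move=> t1 u2 u3 u4 u5 u6 t2 ? ? ? tt h.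
have : r * t1 <= r * t2 by rewrite ler_pM2l.
have : 0 <= r * u2 by rewrite mulr_ge0 // ltW.
have : 0 <= r * u3 by rewrite mulr_ge0 // ltW.
rewrite mulrDl !mulrDr; lra.
Qed.
End Regime.

(** * Estimates off and on the dipole *)

Section Estimates.
Context {R : realType}.
Notation normc := Normc.normc.
Notation plane := (measurableTypeR R * measurableTypeR R)%type.
Notation area := (@area R).
Notation P := (@cross_range_proj R).

Lemma normc_sqr (z : R[i]) : normc z ^+ 2 = complex.Re z ^+ 2 + complex.Im z ^+ 2.
Proof. by case: z => x y /=; rewrite sqr_sqrtr // addr_ge0 ?sqr_ge0. Qed.

Lemma cnorm_le_sum (v : 'cV[R[i]]_3) (N : R) :
  (forall i, normc (v i 0) <= N) -> cnorm v <= 3 * N.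
Proof.
move=> vN; have N0 : 0 <= N by apply: le_trans (vN 0); exact: normc_ge0.
rewrite -[leRHS]ger0_norm ?mulr_ge0 // -sqrtr_sqr ler_sqrt ?sqr_ge0 //.
apply: (@le_trans _ _ (\sum_(i < 3) N ^+ 2)).
  by apply: ler_sum => i _; rewrite -normc_sqr ler_sqr ?nnegrE ?normc_ge0.
by rewrite sumr_const card_ord; have := sqr_ge0 N; rewrite -mulr_natl exprMn; lra.
Qed.

Lemma normc_le_cnorm n (v : 'cV[R[i]]_n) l : normc (v l 0) <= cnorm v.
Proof.
rewrite -[leLHS]ger0_norm ?normc_ge0 // -sqrtr_sqr ler_sqrt.
  rewrite normc_sqr (bigD1 l) //= lerDl; apply: sumr_ge0 => i _.
  by rewrite addr_ge0 ?sqr_ge0.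
by apply: sumr_ge0 => i _; rewrite addr_ge0 ?sqr_ge0.
Qed.

Lemma normc_proj_mul (v : 'cV[R[i]]_3) (M : R) i :
  (forall l, normc (v l 0) <= M) -> normc ((P *m v) i 0) <= 3 * M.
Proof.
move=> vM; rewrite mxE; apply: (le_trans (normc_sum _)).
have -> : 3 * M = \sum_(l < 3) 1 * M by rewrite sumr_const card_ord mul1r mulr_natl.
apply: ler_sum => l _; rewrite Normc.normcM; apply: ler_pM; rewrite ?normc_ge0 //.
exact: normc_proj_le.
Qed.

Lemma norm2_le_sum (x : R * R) : norm2 x <= `|x.1| + `|x.2|.
Proof. by have := normc_le_ReIm (x.1 +i* x.2). Qed.

Lemma norm2_gt0 (x : R * R) : x <> 0 -> 0 < norm2 x.
Proof.
move=> x0; rewrite lt_neqAle sqrtr_ge0 andbT eq_sym; apply/eqP => n0; apply: x0.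
have [] := norm2_ge x; rewrite n0 !normr_le0 => /eqP x1 /eqP x2.
by case: x n0 x1 x2 => u v /= _ -> ->.
Qed.

Lemma amplitude_const_le (L Z : R) : 0 < L -> L / 2 <= Z ->
  0 <= (16 * pi ^+ 2 * Z ^+ 2)^-1 <= 4 / L ^+ 2.
Proof.
move=> L0 LZ; have L2 : 0 < L / 2 by rewrite divr_gt0.
have Z0 : 0 < Z by apply: lt_le_trans LZ.
have p1 : 1 <= 16 * pi ^+ 2 :> R by have := @pi_ge2 R; nra.
rewrite invr_ge0 mulr_ge0 ?exprn_ge0 ?(ltW Z0) ?(le_trans ler01) //=.
rewrite -[4 / _]invf_div lef_pV2 ?posrE ?divr_gt0 ?exprn_gt0 //; last first.
  by rewrite mulr_gt0 ?exprn_gt0 // (lt_le_trans ltr01).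
have -> : L ^+ 2 / 4 = (L / 2) ^+ 2 by field.
rewrite -[leLHS]mul1r; apply: ler_pM => //; first exact: exprn_ge0 (ltW L2).
by rewrite lerXn2r // nnegrE ltW.
Qed.

(** Threshold for a / L, b / L, h / L and 1 / (k L). Since delta + delta B + delta M = 1 / 2, it
    leaves |eta| <= L / 2 and room for B a + M b below L + eta, while 1 / delta >= 2 gives k L >=
    2. *)
Definition regime_delta (B M : R) : R := (2 * (1 + B + M))^-1.

Lemma regime_deltaP (B M k L a b h eta : R) : 0 < B -> 0 < M -> 0 < k -> 0 < L ->
  0 < a -> 0 < b -> 0 < h ->
  a / L <= regime_delta B M -> b / L <= regime_delta B M ->
  h / L <= regime_delta B M -> (k * L)^-1 <= regime_delta B M -> `|eta| <= M * h ->
  [/\ L / 2 <= L + eta <= 2 * L, B * a + M * b <= L + eta, 1 <= k * (L + eta),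
      a <= L & b <= L].
Proof.
move=> B0 M0 k0 L0 a0 b0 h0; set d := regime_delta B M => aL bL hL kL eh.
have S0 : 0 < 2 * (1 + B + M) by rewrite mulr_gt0 // !addr_gt0.
have d0 : 0 < d by rewrite invr_gt0.
have dS : d * (2 * (1 + B + M)) = 1 by rewrite mulVf // gt_eqF.
have {}aL : a <= d * L by rewrite -ler_pdivrMr.
have {}bL : b <= d * L by rewrite -ler_pdivrMr.
have {}hL : h <= d * L by rewrite -ler_pdivrMr.
have d2 : d * 2 + d * B * 2 + d * M * 2 = 1 by rewrite -[RHS]dS; ring.
have dB : 0 < d * B by rewrite mulr_gt0.
have dM : 0 < d * M by rewrite mulr_gt0.
have Mh : M * h <= d * M * L by rewrite [d * M]mulrC -mulrA ler_pM2l.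
have Mb : M * b <= d * M * L by rewrite [d * M]mulrC -mulrA ler_pM2l.
have Ba : B * a <= d * B * L by rewrite [d * B]mulrC -mulrA ler_pM2l.
have {}kL : 2 <= k * L.
  have kL0 : 0 < k * L by rewrite mulr_gt0.
  have : 1 <= d * (k * L) by rewrite -ler_pdivrMr ?mul1r.
  nra.
have L1 : L = d * L * 2 + d * B * L * 2 + d * M * L * 2.
  by rewrite -[LHS]mul1r -{1}d2; ring.
have dL : 0 < d * L by rewrite mulr_gt0.
have dBL : 0 < d * B * L by rewrite mulr_gt0.
have dML : 0 < d * M * L by rewrite mulr_gt0.
move: eh; rewrite ler_norml => /andP[e1 e2].
have Z1 : L / 2 <= L + eta by lra.
split.
- by apply/andP; split => //; lra.
- by lra.
- apply: le_trans (ler_wpM2l (ltW k0) Z1); lra.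
- lra.
- lra.
Qed.

(** The image is a kernel error plus a constant times a Fourier integral over the array: the former
    is absorbed by [error_absorbed] with r = 4 M, the latter is the first error term. [B] and [C]
    are fixed before all parameters and points, which yields uniformity. *)
Lemma image_off_le (A : set (R * R)) (M : R) : array_shape A -> 0 < M ->
  exists B C : R, [/\ 0 < B, 0 <= C &
   forall (mu omega k L a b h : R) (d : dipole R) (y : R * R),
    0 < mu -> 0 < omega -> 0 < k -> 0 < L -> 0 < a -> 0 < b -> 0 < h ->
    a / L <= regime_delta B M -> b / L <= regime_delta B M ->
    h / L <= regime_delta B M -> (k * L)^-1 <= regime_delta B M ->
    `|offset d| <= M * h -> norm2 (crange d) <= M * b -> norm2 y <= M * b ->
    cnorm (polar d) <= M -> y <> crange d ->
    cnorm (image_dipole mu omega k L (scale_set a A) d y) <=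
      a ^+ 2 / L ^+ 2 * (C * (L / (a * k * norm2 (y - crange d))
         + aperture_term k L a + k * b ^+ 2 / L))].
Proof.
move=> sA M0; have [B B0 AB] := array_shape_bounded sA.
have [K K0 HK] := array_fourier_decay sA.
have [W W0 HW] := @kirchhoff_approx R.
pose Ce : R := 2 * B + 2 * M + 2 + 8 * B ^+ 4 + 2 * M ^+ 2.
have Ce0 : 0 <= Ce.
  by rewrite /Ce; have := exprn_ge0 4 (ltW B0); have := sqr_ge0 M; lra.
(* 16 = 4 * 4 from the amplitude constant 4 / L^2 and the area 4 B^2 a^2; 48 = 4 * 3 * 4 from that
   constant, the projected polarization 3 M and the oscillatory bound 4 K; the outer 3 passes from
   entries to the norm. *)
exists B, (3 * (16 * W * M * B ^+ 2 * (Ce * (3 * (4 * M) + 4)) + 48 * M * K)).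
split => //.
  have M0' := ltW M0; apply: mulr_ge0 => //; apply: addr_ge0; last by rewrite !mulr_ge0.
  apply: mulr_ge0; first by rewrite !mulr_ge0 // ltW.
  by apply: mulr_ge0 => //; apply: addr_ge0 => //; rewrite !mulr_ge0.
move=> mu omega k L a b h [y' eta pol] y /= mu0 om0 k0 L0 a0 b0 h0 aL bL hL kL eh y'b yb polM yy'.
have [/andP[Z1 Z2] pqZ kZ aL1 bL1] := regime_deltaP B0 M0 k0 L0 a0 b0 h0 aL bL hL kL eh.
set Z := L + eta in Z1 Z2 pqZ kZ *.
have Z0 : 0 < Z by apply: lt_le_trans Z1; rewrite divr_gt0.
have an0 : a != 0 by rewrite gt_eqF.
set S := scale_set a A.
have mS : measurable (S : set plane) by apply: measurable_scale_set => //; case: sA.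
have Sp x : S x -> `|x.1| <= B * a /\ `|x.2| <= B * a.
  by move=> [z /AB[z1 z2] <-] /=; rewrite !normrM (gtr0_norm a0) ![a * _]mulrC !ler_pM2r.
have Ba0 : 0 <= B * a by rewrite mulr_ge0 // ltW.
have aS := area_le_box mS Ba0 Sp.
have Soo : (area S < +oo)%E by apply: le_lt_trans aS (ltry _).
have fS : 0 <= fine (area S) <= 4 * B ^+ 2 * a ^+ 2.
  rewrite fine_ge0 ?measure_ge0 //= -lee_fin fineK ?ge0_fin_numE ?measure_ge0 //.
  by rewrite (le_trans aS) // lee_fin le_eqVlt; apply/orP; left; apply/eqP; ring.
have [y1 y2] := norm2_ge y; have [y'1 y'2] := norm2_ge y'.
have yq1 := le_trans y1 yb; have yq2 := le_trans y2 yb.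
have y'q1 := le_trans y'1 y'b; have y'q2 := le_trans y'2 y'b.
have polMl l : normc (pol l 0) <= M by apply: le_trans (normc_le_cnorm _ _) polM.
set D := norm2 (y - y').
have D0 : 0 < D by apply: norm2_gt0 => /subr0_eq.
have DMb : D <= (4 * M) * b.
  apply: (le_trans (norm2_le_sum _)) => /=.
  have -> : 4 * M * b = (M * b + M * b) + (M * b + M * b) by ring.
  by apply: lerD; apply: le_trans (ler_normB _ _) (lerD _ _).
set E1 := L / (a * k * D).
set E := E1 + aperture_term k L a + k * b ^+ 2 / L.
have E10 : 0 <= E1 by rewrite divr_ge0 ?mulr_ge0 // ltW.
have E1E : E1 <= E.
  rewrite /E -addrA lerDl addr_ge0 // /aperture_term !mulr_ge0 ?invr_ge0 ?exprn_ge0 // ltW //.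
have M40 : 0 < 4 * M by rewrite mulr_gt0.
have errE : kernel_error (B * a) (M * b) k Z <= Ce * ((3 * (4 * M) + 4) * E).
  apply: le_trans (kernel_error_le k0 L0 a0 b0 B0 M0 Z1) _.
  by rewrite ler_wpM2l //; apply: error_absorbed.
have err0 : 0 <= kernel_error (B * a) (M * b) k Z.
  by apply: kernel_error_ge0 => //; rewrite mulr_ge0 // ltW.
have /andP[c0 cL] := amplitude_const_le L0 Z1.
pose xi : R * R := (k / Z * (y - y').1, k / Z * (y - y').2).
have nxi : norm2 xi = k / Z * D by rewrite norm2Z ger0_norm // divr_ge0 // ltW.
have xi0 : 0 < norm2 xi by rewrite nxi !mulr_gt0 // invr_gt0.
(* With |xi| = k D / Z and Z <= 2 L, the decay a / |xi| is at most 2 a L / (k D) = 2 a^2 E1; the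
   other factor 2 adds the cosine and sine parts. *)
have osc : normc (cintegral area S (fun x => expi (cross_phase y y' Z k x))) <=
    4 * K * (a ^+ 2 * E1).
  have [HKc HKs] := HK a xi a0 xi0.
  apply: (le_trans (normc_le_ReIm _)); rewrite /cintegral /=.
  have ph x : cross_phase y y' Z k x = xi.1 * x.1 + xi.2 * x.2.
    by rewrite /cross_phase /xi /=; field; rewrite gt_eqF.
  under eq_Rintegral do rewrite ph.
  under [X in _ + `|X|]eq_Rintegral do rewrite ph.
  apply: le_trans (lerD HKc HKs) _; rewrite nxi.
  have -> : a / (k / Z * D) = a / (k * D) * Z by field; rewrite !gt_eqF.
  have : a / (k * D) * Z <= a / (k * D) * (2 * L).
    by rewrite ler_wpM2l // divr_ge0 ?mulr_ge0 // ltW.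
  have -> : a / (k * D) * (2 * L) = 2 * (a ^+ 2 * E1).
    by rewrite /E1; field; rewrite !gt_eqF.
  by move=> /(ler_wpM2l K0) h1; rewrite (_ : 4 * K * _ = K * (2 * (a ^+ 2 * E1)) * 2);
    [rewrite mulr_natr mulr2n lerD|ring].
suff comp i : normc (kirchhoff mu omega k S
    (dipole_data mu omega k (Defs.point y' Z) pol) (Defs.point y Z) i 0) <=
    a ^+ 2 / L ^+ 2 * ((16 * W * M * B ^+ 2 * (Ce * (3 * (4 * M) + 4)) + 48 * M * K) * E).
  rewrite /image_dipole /= -/S -/Z; apply: (le_trans (cnorm_le_sum comp)).
  by rewrite le_eqVlt; apply/orP; left; apply/eqP; ring.
have H := HW _ _ _ _ _ _ _ _ _ _ _ i mS Soo Sp yq1 yq2 y'q1 y'q2 Z0 kZ pqZ Ba0 mu0 om0 polMl.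
rewrite -[X in normc X](subrK (((16 * pi ^+ 2 * Z ^+ 2)^-1)%:C * (P *m pol) i 0
  * cintegral area S (fun x => expi (cross_phase y y' Z k x)))).
apply: (le_trans (ler_normcD _ _)).
have H2 : normc (((16 * pi ^+ 2 * Z ^+ 2)^-1)%:C * (P *m pol) i 0
  * cintegral area S (fun x => expi (cross_phase y y' Z k x))) <=
   4 / L ^+ 2 * (3 * M) * (4 * K * (a ^+ 2 * E1)).
  rewrite !Normc.normcM normc_real (ger0_norm c0).
  apply: ler_pM => //; rewrite ?mulr_ge0 ?normc_ge0 //.
  by apply: ler_pM; rewrite ?normc_ge0 ?normc_proj_mul.
have H1 : W * M * (16 * pi ^+ 2 * Z ^+ 2)^-1 * kernel_error (B * a) (M * b) k Z
    * fine (area S) <=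
    W * M * (4 / L ^+ 2) * (Ce * ((3 * (4 * M) + 4) * E)) * (4 * B ^+ 2 * a ^+ 2).
  have M20 : 0 <= W * M by rewrite mulr_ge0 // ltW.
  case/andP: fS => fS0 fS1.
  apply: ler_pM => //; first by apply: mulr_ge0 => //; exact: mulr_ge0.
  apply: ler_pM => //; first exact: mulr_ge0.
  by rewrite ler_wpM2l.
apply: le_trans (lerD (le_trans H H1) H2) _.
have -> : W * M * (4 / L ^+ 2) * (Ce * ((3 * (4 * M) + 4) * E)) * (4 * B ^+ 2 * a ^+ 2)
  + 4 / L ^+ 2 * (3 * M) * (4 * K * (a ^+ 2 * E1)) =
  a ^+ 2 / L ^+ 2 * (16 * W * M * B ^+ 2 * (Ce * (3 * (4 * M) + 4)) * E + 48 * M * K * E1).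
  by field; rewrite gt_eqF.
apply: ler_wpM2l; first by rewrite divr_ge0 ?sqr_ge0.
rewrite [leRHS]mulrDl lerD2l; apply: ler_wpM2l => //.
by do 2![apply: mulr_ge0 => //]; exact: ltW.
Qed.
End Estimates.

(** * The image at the dipole, for a disk *)

Section OnDipole.
Context {R : realType}.
Notation normc := Normc.normc.
Notation plane := (measurableTypeR R * measurableTypeR R)%type.
Notation area := (@area R).
Notation P := (@cross_range_proj R).

(** Area times prefactor is a^2 / (16 pi Z^2). Passing from Z to L costs, relative to a^2 / L^2, the
    amount |eta| (Z + L) / (16 pi Z^2); here Z + L <= 3 L and 16 pi Z^2 >= L^2 / 4, hence 12. *)
Lemma peak_const_approx (L Z eta a e : R) : 0 < L -> Z = L + eta ->
  L / 2 <= Z <= 2 * L -> `|eta| <= e ->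
  `|(16 * pi ^+ 2 * Z ^+ 2)^-1 * (pi * a ^+ 2) - a ^+ 2 / (16 * pi * L ^+ 2)|
  <= a ^+ 2 / L ^+ 2 * (12 * (e / L)).
Proof.
move=> L0 ZE /andP[Z1 Z2] eL; have L2 : 0 < L / 2 by rewrite divr_gt0.
have Z0 : 0 < Z by apply: lt_le_trans Z1.
have p2 := @pi_ge2 R; move: (@pi R) p2 => p p2.
have p0 : 0 < p by lra.
have -> : (16 * p ^+ 2 * Z ^+ 2)^-1 * (p * a ^+ 2) - a ^+ 2 / (16 * p * L ^+ 2) =
    a ^+ 2 / L ^+ 2 * (- (eta * (Z + L)) * (16 * p * Z ^+ 2)^-1).
  by rewrite ZE; field; rewrite -ZE !gt_eqF.
have Zi : (16 * p * Z ^+ 2)^-1 <= (L ^+ 2 / 4)^-1.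
  rewrite lef_pV2 ?posrE ?mulr_gt0 ?exprn_gt0 ?invr_gt0 //.
  have -> : L ^+ 2 / 4 = 1 * (L / 2) ^+ 2 by field.
  apply: ler_pM => //; rewrite ?exprn_ge0 ?(ltW L2) //; first by lra.
  by rewrite lerXn2r // nnegrE ltW.
have Zi0 : 0 <= (16 * p * Z ^+ 2)^-1.
  by rewrite invr_ge0 ltW // mulr_gt0 ?exprn_gt0 // mulr_gt0.
rewrite normrM ger0_norm ?divr_ge0 ?sqr_ge0 //; apply: ler_wpM2l.
  by rewrite divr_ge0 ?sqr_ge0.
rewrite normrM normrN normrM (ger0_norm Zi0).
have ZL : `|Z + L| <= 3 * L by rewrite ger0_norm; lra.
have h := ler_pM (normr_ge0 _) (normr_ge0 _) eL ZL.
have := ler_pM (mulr_ge0 (normr_ge0 _) (normr_ge0 _)) Zi0 h Zi.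
by rewrite (_ : e * (3 * L) / (L ^+ 2 / 4) = 12 * (e / L)) //; field; rewrite gt_eqF.
Qed.

Lemma cross_phase_diag (y : R * R) (Z k : R) (x : plane) : cross_phase y y Z k x = 0.
Proof. by rewrite /cross_phase !subrr !mulr0 addr0 mulr0 mul0r. Qed.

Lemma col_subZ n (u v : 'cV[R[i]]_n) (z : R[i]) i :
  (u - z *: v) i 0 = u i 0 - z * v i 0.
Proof. by rewrite !mxE. Qed.

Lemma split_const (u v : R[i]) (c s z : R) :
  u - z%:C * v = (u - c%:C * v * s%:C) + (c * s - z)%:C * v.
Proof. by rewrite rmorphB rmorphM /=; ring. Qed.

(** Only a bound tending to 0 is required here, so the first order amplitude errors stay on the
    right; h / L is added by the passage from range L + eta to L. *)
Lemma image_on_le (M : R) : 0 < M ->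
  exists2 C : R, 0 <= C &
   forall (mu omega k L a b h : R) (d : dipole R),
    0 < mu -> 0 < omega -> 0 < k -> 0 < L -> 0 < a -> 0 < b -> 0 < h ->
    a / L <= regime_delta 1 M -> b / L <= regime_delta 1 M ->
    h / L <= regime_delta 1 M -> (k * L)^-1 <= regime_delta 1 M ->
    `|offset d| <= M * h -> norm2 (crange d) <= M * b -> cnorm (polar d) <= M ->
    cnorm (image_dipole mu omega k L (disk a) d (crange d)
           - (a ^+ 2 / (16 * pi * L ^+ 2))%:C *: (P *m polar d)) <=
      a ^+ 2 / L ^+ 2 * (C * (a / L + b / L + (k * L)^-1 + aperture_term k L a
         + k * b ^+ 2 / L + h / L)).
Proof.
move=> M0; have B0 : 0 < (1 : R) by [].
have [W W0 HW] := @kirchhoff_approx R.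
pose Ce : R := 2 * 1 + 2 * M + 2 + 8 * 1 ^+ 4 + 2 * M ^+ 2.
have Ce0 : 0 <= Ce by rewrite /Ce expr1n; have := sqr_ge0 M; lra.
have C10 : 0 <= 16 * W * M * Ce by rewrite !mulr_ge0 // ltW.
have C20 : 0 <= 36 * M ^+ 2 by rewrite mulr_ge0 ?sqr_ge0.
(* 16 = 4 * 4 from the amplitude constant and pi <= 4; 36 M^2 = 12 M * 3 M from the change of range
   and the projected polarization. *)
exists (3 * (16 * W * M * Ce + 36 * M ^+ 2)); first by rewrite mulr_ge0 ?addr_ge0.
move=> mu omega k L a b h [y eta pol] /= mu0 om0 k0 L0 a0 b0 h0 aL bL hL kL eh yb polM.
have [Z12 pqZ kZ aL1 bL1] := regime_deltaP B0 M0 k0 L0 a0 b0 h0 aL bL hL kL eh.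
have /andP[Z1 Z2] := Z12.
move: Z12 Z1 Z2 pqZ kZ; move E : (L + eta) => Z Z12 Z1 Z2 pqZ kZ.
have Z0 : 0 < Z by apply: lt_le_trans Z1; rewrite divr_gt0.
have mS := measurable_disk a.
have Sp x : disk a x -> `|x.1| <= 1 * a /\ `|x.2| <= 1 * a.
  rewrite mul1r => xa; have [x1 x2] := norm2_ge x.
  by split; [apply: le_trans x1 _|apply: le_trans x2 _].
have aS := area_disk a0.
have Soo : (area (disk a) < +oo)%E by rewrite aS ltry.
have [y1 y2] := norm2_ge y.
have yq1 := le_trans y1 yb; have yq2 := le_trans y2 yb.
have polMl l : normc (pol l 0) <= M by apply: le_trans (normc_le_cnorm _ _) polM.
have Ba0 : 0 <= 1 * a by rewrite mul1r ltW.
have errE := kernel_error_le k0 L0 a0 b0 B0 M0 Z1; rewrite -/Ce in errE.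
have err0 : 0 <= kernel_error (1 * a) (M * b) k Z.
  by apply: kernel_error_ge0 => //; rewrite mulr_ge0 // ltW.
have /andP[c0 cL] := amplitude_const_le L0 Z1.
set rho := a / L + b / L + (k * L)^-1 + aperture_term k L a + k * b ^+ 2 / L in errE *.
have osc : cintegral area (disk a) (fun x => expi (cross_phase y y Z k x)) = (pi * a ^+ 2)%:C.
  rewrite /cintegral /=.
  under eq_Rintegral do rewrite cross_phase_diag cos0.
  under [X in _ +i* X]eq_Rintegral do rewrite cross_phase_diag sin0.
  by rewrite !Rintegral_cst // mul0r mul1r [X in fine X]aS.
have p0 := @pi_gt0 R.
suff comp i : normc ((image_dipole mu omega k L (disk a) (Dipole y eta pol) y
     - (a ^+ 2 / (16 * pi * L ^+ 2))%:C *: (P *m pol)) i 0) <=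
    a ^+ 2 / L ^+ 2 * ((16 * W * M * Ce + 36 * M ^+ 2) * (rho + h / L)).
  apply: (le_trans (cnorm_le_sum comp)).
  by rewrite le_eqVlt; apply/orP; left; apply/eqP; ring.
have H := HW _ _ _ _ _ _ _ _ _ _ _ i mS Soo Sp yq1 yq2 yq1 yq2 Z0 kZ pqZ Ba0 mu0 om0 polMl.
rewrite osc aS /= in H.
rewrite col_subZ /image_dipole /= E.
rewrite (split_const _ _ ((16 * pi ^+ 2 * Z ^+ 2)^-1) (pi * a ^+ 2)).
apply: le_trans (ler_normcD _ _) _.
have H2 : normc (((16 * pi ^+ 2 * Z ^+ 2)^-1 * (pi * a ^+ 2) - a ^+ 2 / (16 * pi * L ^+ 2))%:C
    * (P *m pol) i 0) <= a ^+ 2 / L ^+ 2 * (12 * (M * h / L)) * (3 * M).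
  rewrite Normc.normcM normc_real; apply: ler_pM; rewrite ?normc_ge0 ?normc_proj_mul //.
  exact: (peak_const_approx _ L0 (esym E) Z12 eh).
have H1 : W * M * (16 * pi ^+ 2 * Z ^+ 2)^-1 * kernel_error (1 * a) (M * b) k Z
    * (pi * a ^+ 2) <= W * M * (4 / L ^+ 2) * (Ce * rho) * (4 * a ^+ 2).
  have M20 : 0 <= W * M by rewrite mulr_ge0 // ltW.
  apply: ler_pM => //.
  - by apply: mulr_ge0 => //; exact: mulr_ge0.
  - by rewrite mulr_ge0 ?sqr_ge0 // ltW.
  - apply: ler_pM => //; first exact: mulr_ge0.
    by rewrite ler_wpM2l.
  - rewrite ler_wpM2r ?sqr_ge0 //.
    by move: (@pihalf_lt2 R); rewrite ltr_pdivrMr // -natrM => /ltW.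
apply: le_trans (lerD (le_trans H H1) H2) _.
have -> : W * M * (4 / L ^+ 2) * (Ce * rho) * (4 * a ^+ 2)
  + a ^+ 2 / L ^+ 2 * (12 * (M * h / L)) * (3 * M) =
  a ^+ 2 / L ^+ 2 * (16 * W * M * Ce * rho + 36 * M ^+ 2 * (h / L)).
  by field; rewrite gt_eqF.
have rho0 : 0 <= rho.
  have := le_trans err0 errE; rewrite pmulr_rge0 // /Ce expr1n; have := sqr_ge0 M; lra.
have hL0 : 0 <= h / L by rewrite divr_ge0 // ltW.
apply: ler_wpM2l; first by rewrite divr_ge0 ?sqr_ge0.
move: C10 C20 rho0 hL0; move: (16 * _ * _ * _) (36 * _) (h / L) => u v t ? ? ? ?.
have -> : (u + v) * (rho + t) = u * rho + v * t + (u * t + v * rho) by ring.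
by rewrite lerDl addr_ge0 // mulr_ge0.
Qed.
End OnDipole.

(** * Asymptotics *)

Section Asymptotic.
Context {R : realType} {T : Type} (F : set_system T) {FF : ProperFilter F}.

Lemma much_less_le (X Y : T -> R) (e : R) : much_less F X Y -> 0 < e ->
  \forall t \near F, X t / Y t <= e.
Proof.
rewrite /much_less => /cvgr0_norm_le H e0.
by apply: filterS (H _ e0) => t; apply: le_trans; exact: ler_norm.
Qed.

(** A bound by a sum is shared out in proportion: r = N / (s (E1 + E2 + E3)) lies in [0, C], and the
    parts r E1, r E2, r E3 recompose N / s exactly. Positivity of [E1] makes the division
    legitimate; in the application it comes from y differing from the dipole. *)
Lemma split_error (Q : Type) (W : T -> set Q) (N E1 E2 E3 : T -> Q -> R) (s : T -> R) (C : R) :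
  (forall t q, W t q -> 0 <= N t q) -> (forall t, 0 < s t) -> 0 <= C ->
  (forall t q, W t q -> 0 < E1 t q) ->
  (forall t q, 0 <= E2 t q) -> (forall t q, 0 <= E3 t q) ->
  (\forall t \near F, forall q, W t q ->
     N t q <= s t * (C * (E1 t q + E2 t q + E3 t q))) ->
  (forall e, 0 < e -> \forall t \near F, forall q, W t q -> E2 t q + E3 t q <= e) ->
  exists e1 e2 e3 : T -> Q -> R,
    [/\ \forall t \near F, forall q, W t q ->
          N t q = s t * (e1 t q + (e2 t q + e3 t q)),
        unif_bigO F W e1 E1, unif_bigO F W e2 E2, unif_bigO F W e3 E3
      & unif_littleo F W (fun t q => e2 t q + e3 t q) (fun _ _ => 1)].
Proof.
move=> N0 s0 C0 E10 E20 E30 NE E23.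
pose r t q := N t q / s t / (E1 t q + E2 t q + E3 t q).
have S0 t q : W t q -> 0 < E1 t q + E2 t q + E3 t q.
  by move=> Wq; rewrite -addrA ltr_pwDl ?E10 // addr_ge0.
have rC : \forall t \near F, forall q, W t q -> 0 <= r t q <= C.
  apply: filterS NE => t H q Wq; have S := S0 t q Wq.
  rewrite /r !divr_ge0 ?N0 ?(ltW S) ?(ltW (s0 t)) //=.
  by rewrite ler_pdivrMr // ler_pdivrMr // mulrC; apply: H.
have bigO (E : T -> Q -> R) : (forall t q, W t q -> 0 <= E t q) ->
    unif_bigO F W (fun t q => r t q * E t q) E.
  move=> E0; exists C; apply: filterS rC => t H q Wq.
  have /andP[r0 rC'] := H q Wq.
  by rewrite normrM (ger0_norm r0) ler_wpM2r.
exists (fun t q => r t q * E1 t q), (fun t q => r t q * E2 t q), (fun t q => r t q * E3 t q).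
split.
- apply: filterE => t q Wq; rewrite addrA -!mulrDr /r.
  by field; rewrite !gt_eqF // S0.
- by apply: bigO => t q /E10/ltW.
- by apply: bigO.
- by apply: bigO.
- move=> e e0; have C1 : 0 < C + 1 by rewrite ltr_wpDl.
  have := E23 _ (divr_gt0 e0 C1); apply: filterS2 rC => t H H' q Wq.
  have /andP[r0 rC'] := H q Wq.
  rewrite -mulrDr normrM (ger0_norm r0) ger0_norm ?addr_ge0 // normr1 mulr1.
  apply: (@le_trans _ _ ((C + 1) * (e / (C + 1)))).
    by apply: ler_pM; rewrite ?addr_ge0 ?H' // (le_trans rC') // lerDl.
  by rewrite mulrC divfK // gt_eqF.
Qed.
End Asymptotic.

Theorem proposition2p2 (R : realType) (c mu : R) (hc : 0 < c) (hmu : 0 < mu)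
    (T : Type) (F : set_system T) (FF : ProperFilter F)
    (omega k L a b h : T -> R)
    (homega : forall t, 0 < omega t)
    (hk : forall t, k t = omega t / c)
    (hF : fraunhofer F k L a b h)
    (M : R) (hM : 0 < M) :
  (forall A : set (R * R), array_shape A ->
    exists e1 e2 e3 : T -> dipole R * (R * R) -> R,
      [/\ (\forall t \near F, forall q, admissible_off M b h t q ->
             cnorm (image_dipole mu (omega t) (k t) (L t)
                      (scale_set (a t) A) q.1 q.2)
             = a t ^+ 2 / L t ^+ 2 * (e1 t q + (e2 t q + e3 t q))),
          unif_bigO F (admissible_off M b h) e1
            (fun t q => L t / (a t * k t * norm2 (q.2 - crange q.1))),
          unif_bigO F (admissible_off M b h) e2
            (fun t _ => a t ^+ 2 * Theta k L a t / L t ^+ 2),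
          unif_bigO F (admissible_off M b h) e3
            (fun t _ => Theta k L b t)
        & unif_littleo F (admissible_off M b h)
            (fun t q => e2 t q + e3 t q) (fun _ _ => 1)])
  /\
  unif_littleo F (admissible M b h)
    (fun t d =>
       cnorm (image_dipole mu (omega t) (k t) (L t) (disk (a t)) d (crange d)
              - (a t ^+ 2 / (16 * pi * L t ^+ 2))%:C
                  *: (cross_range_proj *m polar d)))
    (fun t _ => a t ^+ 2 / L t ^+ 2).
Proof.
case: hF => pos kL aL bL hL Tb _ TaL _.
have s0 t : 0 < a t ^+ 2 / L t ^+ 2.
  by have [_ ? ? _ _] := pos t; rewrite divr_gt0 ?exprn_gt0.
have E2_0 t : 0 <= a t ^+ 2 * Theta k L a t / L t ^+ 2.
  by have [? ? ? _ _] := pos t; rewrite /Theta ltW // !(divr_gt0, mulr_gt0, exprn_gt0).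
have E3_0 t : 0 <= Theta k L b t.
  by have [? ? _ ? _] := pos t; rewrite /Theta ltW // !(divr_gt0, mulr_gt0, exprn_gt0).
(* The hypothesis that Theta_a / (L^2 / a^2) tends to 0 is, once the quotient is cleared, the
   statement that this term does. *)
have small_E2 e : 0 < e -> \forall t \near F, a t ^+ 2 * Theta k L a t / L t ^+ 2 <= e.
  move=> e0; apply: filterS (much_less_le TaL e0) => t.
  have [_ L0 a0 _ _] := pos t.
  by rewrite (_ : _ / (_ / _) = a t ^+ 2 * Theta k L a t / L t ^+ 2) //; field; rewrite !gt_eqF.
have small_E3 e : 0 < e -> \forall t \near F, Theta k L b t <= e.
  by move=> e0; apply: filterS (much_less_le Tb e0) => t; rewrite divr1.
have small_kL e : 0 < e -> \forall t \near F, (k t * L t)^-1 <= e.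
  by move=> e0; apply: filterS (much_less_le kL e0) => t; rewrite mul1r.
have delta0 (B : R) : 0 < B -> 0 < regime_delta B M.
  by move=> B0; rewrite invr_gt0 mulr_gt0 // !addr_gt0.
split.
- move=> A sA; have [B [C [B0 C0 HC]]] := image_off_le sA hM.
  have d0 := delta0 B B0.
  apply: (@split_error R T F _ _ (admissible_off M b h)
     (fun t q => cnorm (image_dipole mu (omega t) (k t) (L t) (scale_set (a t) A) q.1 q.2))
     (fun t q => L t / (a t * k t * norm2 (q.2 - crange q.1)))
     (fun t _ => a t ^+ 2 * Theta k L a t / L t ^+ 2)
     (fun t _ => Theta k L b t) _ C) => //.
  + by move=> t q _; exact: sqrtr_ge0.
  + move=> t q [_ _ ne]; have [k0 L0 a0 _ _] := pos t.
    by rewrite divr_gt0 // !mulr_gt0 // norm2_gt0 // => /subr0_eq.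
  (* The limit serves only to bring the four ratios below the threshold; the estimate itself is
     uniform in the dipole and the imaging point. *)
  + have near_a := much_less_le aL d0; have near_b := much_less_le bL d0.
    have near_h := much_less_le hL d0; have near_k := small_kL _ d0.
    near=> t; move=> [d y] [[[yb eh] polM] [y'b _] ne].
    have [k0 L0 a0 b0 h0] := pos t.
    have a1 : a t / L t <= regime_delta B M by near: t; exact: near_a.
    have b1 : b t / L t <= regime_delta B M by near: t; exact: near_b.
    have h1 : h t / L t <= regime_delta B M by near: t; exact: near_h.
    have k1 : (k t * L t)^-1 <= regime_delta B M by near: t; exact: near_k.
    exact: (HC mu (omega t) (k t) (L t) (a t) (b t) (h t) d y hmu (homega t)
      k0 L0 a0 b0 h0 a1 b1 h1 k1 eh yb y'b polM ne).
  + move=> e e0; have e2 : 0 < e / 2 by rewrite divr_gt0.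
    have near_2 := small_E2 _ e2; have near_3 := small_E3 _ e2.
    near=> t; move=> q _; rewrite [leRHS]splitr; apply: lerD.
      by near: t; exact: near_2.
    by near: t; exact: near_3.
- have [C C0 HC] := image_on_le hM.
  have d0 := delta0 1 ltr01.
  (* Six error terms share e; [C + 1] in place of [C] avoids a division by 0. *)
  move=> e e0; pose e' := e / (6 * (C + 1)).
  have C1 : 0 < C + 1 by rewrite ltr_wpDl.
  have e'0 : 0 < e' by rewrite divr_gt0 // mulr_gt0.
  have near_a := much_less_le aL d0; have near_b := much_less_le bL d0.
  have near_h := much_less_le hL d0; have near_k := small_kL _ d0.
  have near_a' := much_less_le aL e'0; have near_b' := much_less_le bL e'0.
  have near_h' := much_less_le hL e'0; have near_k' := small_kL _ e'0.
  have near_2 := small_E2 _ e'0; have near_3 := small_E3 _ e'0.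
  near=> t; move=> d [[yb eh] polM].
  have [k0 L0 a0 b0 h0] := pos t.
  have a1 : a t / L t <= regime_delta 1 M by near: t; exact: near_a.
  have b1 : b t / L t <= regime_delta 1 M by near: t; exact: near_b.
  have h1 : h t / L t <= regime_delta 1 M by near: t; exact: near_h.
  have k1 : (k t * L t)^-1 <= regime_delta 1 M by near: t; exact: near_k.
  have a2 : a t / L t <= e' by near: t; exact: near_a'.
  have b2 : b t / L t <= e' by near: t; exact: near_b'.
  have h2 : h t / L t <= e' by near: t; exact: near_h'.
  have k2 : (k t * L t)^-1 <= e' by near: t; exact: near_k'.
  have E2e : aperture_term (k t) (L t) (a t) <= e' by near: t; exact: near_2.
  have E3e : k t * b t ^+ 2 / L t <= e' by near: t; exact: near_3.
  rewrite ger0_norm ?sqrtr_ge0 // (ger0_norm (ltW (s0 t))) [leRHS]mulrC.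
  have H : a t / L t + b t / L t + (k t * L t)^-1 + aperture_term (k t) (L t) (a t)
     + k t * b t ^+ 2 / L t + h t / L t <= 6 * e'.
    have -> : 6 * e' = e' + e' + e' + e' + e' + e' by ring.
    by do 5![apply: lerD => //].
  apply: le_trans (HC mu (omega t) (k t) (L t) (a t) (b t) (h t) d hmu (homega t)
    k0 L0 a0 b0 h0 a1 b1 h1 k1 eh yb polM) _.
  rewrite ler_pM2l //; apply: le_trans (ler_wpM2l C0 H) _.
  have -> : C * (6 * e') = C / (C + 1) * e by rewrite /e'; field; rewrite gt_eqF.
  by rewrite -[leRHS]mul1r ler_pM2r // ler_pdivrMr // mul1r lerDl.
Unshelve. all: by end_near. Qed.
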